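(* Let $H$ be a finite-dimensional semisimple Hopf algebra over an algebraically closed field $k$ of characteristic $0$ such that $R(H)$ is commutative, and let $\chi=\chi_V$ be a faithful character of $H$. Let $t$ be the number of distinct values in the set $\chi(H)=\{\langle\chi,\eta_j\rangle\mid 0\le j\le m-1\}$. Then every irreducible character $\mu$ of $H$ appears with positive multiplicity in at least one of $\varepsilon,\chi,\chi^2,\dots,\chi^{t-1}$.
   Context: A character $\chi_V$ of a finite-dimensional left $H$-module $V$ is faithful if $\mathrm{LKer}_V=k1$, where $\mathrm{LKer}_V=\{h\in H\mid\sum h_1\otimes h_2\cdot v=h\otimes v\ \forall v\in V\}$. $d=\dim H$; $\Lambda\in H$ is the (two-sided) integral of $H$ and $\lambda\in H^*$ the integral of $H^*$ with $\langle\lambda,\Lambda\rangle=1$; for $h\in H$, $p\in H^*$, $h\leftharpoonup p=\sum\langle p,h_1\rangle h_2$. $R(H)\subset H^*$ is the span of the irreducible characters; $F_0=\frac1d\lambda,\dots,F_{m-1}$ are its (central) primitive idempotents, and $\eta_j=\frac{1}{\dim(F_jH^* )}(\Lambda\leftharpoonup dF_j)$. *)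

(* Defs.v *)
(* Finite-dimensional Hopf algebras are presented by structure
   constants with respect to a fixed basis e_0, ..., e_(d-1) of H = k^d. *)
From HB Require Import structures.
From mathcomp Require Import all_boot all_order all_algebra.
Set Implicit Arguments. Unset Strict Implicit. Unset Printing Implicit Defensive.
Import Order.TTheory GRing.Theory Num.Theory.
Local Open Scope ring_scope.

Section HopfDefs.
Variables (k : fieldType) (d : nat).

(* Structure constants:
   hm a b   = coordinates of e_a e_b;
   h1       = coordinates of the unit 1_H;
   hD a     = matrix M with Delta(e_a) = sum_{b,c} M b c  e_b (x) e_c;
   he a     = epsilon(e_a);
   hS a     = coordinates of S(e_a). *)
Record hopf := Hopf {
  hm : 'I_d -> 'I_d -> 'rV[k]_d;
  h1 : 'rV[k]_d;
  hD : 'I_d -> 'M[k]_d;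
  he : 'I_d -> k;
  hS : 'I_d -> 'rV[k]_d }.

Variable H : hopf.

Definition ebas (a : 'I_d) : 'rV[k]_d := delta_mx 0 a.
Definition hmul (x y : 'rV[k]_d) : 'rV[k]_d :=
  \sum_(a < d) \sum_(b < d) (x 0 a * y 0 b) *: hm H a b.
Definition hcomul (x : 'rV[k]_d) : 'M[k]_d := \sum_(a < d) x 0 a *: hD H a.
Definition hcounit (x : 'rV[k]_d) : k := \sum_(a < d) x 0 a * he H a.
(* multiplication in H (x) H, tensors written as d x d coefficient matrices *)
Definition tmul (X Y : 'M[k]_d) : 'M[k]_d :=
  \matrix_(u, v) \sum_(p < d) \sum_(q < d) \sum_(r < d) \sum_(s < d)
     (X p q * Y r s * ((hm H p r) 0 u * (hm H q s) 0 v)).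

Definition is_hopf : Prop :=
  [/\ (forall x y z, hmul (hmul x y) z = hmul x (hmul y z)),
      (forall x, hmul (h1 H) x = x /\ hmul x (h1 H) = x),
      (forall a p q r : 'I_d, \sum_(b < d) hD H a b r * hD H b p q
                           = \sum_(c < d) hD H a p c * hD H c q r),
      (forall a b : 'I_d, \sum_(c < d) hD H a c b * he H c = (a == b)%:R
                      /\ \sum_(c < d) hD H a b c * he H c = (a == b)%:R)
    & [/\ ((forall x y, hcomul (hmul x y) = tmul (hcomul x) (hcomul y))
        /\ hcomul (h1 H) = (h1 H)^T *m (h1 H)),
      ((forall x y, hcounit (hmul x y) = hcounit x * hcounit y)
        /\ hcounit (h1 H) = 1)
    &
      (forall a : 'I_d,
        \sum_(b < d) \sum_(c < d) hD H a b c *: hmul (hS H b) (ebas c) = he H a *: h1 H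
     /\ \sum_(b < d) \sum_(c < d) hD H a b c *: hmul (ebas b) (hS H c) = he H a *: h1 H)]].

(* Finite-dimensional left H-modules: V = k^n (column vectors), rho a is the
   matrix of the action of e_a. *)
Definition act n (rho : 'I_d -> 'M[k]_n) (x : 'rV[k]_d) : 'M[k]_n :=
  \sum_(a < d) x 0 a *: rho a.
Definition is_hmod n (rho : 'I_d -> 'M[k]_n) : Prop :=
  (forall x y, act rho (hmul x y) = act rho x *m act rho y) /\ act rho (h1 H) = 1%:M.

(* A subspace of V, given as the row space of U (rows = transposed column
   vectors), is a submodule. *)
Definition stable n (rho : 'I_d -> 'M[k]_n) (U : 'M[k]_n) : Prop :=
  forall a, (U *m (rho a)^T <= U)%MS.
Definition irr_mod n (rho : 'I_d -> 'M[k]_n) : Prop :=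
  (0 < n)%N /\ forall U : 'M[k]_n, stable rho U -> \rank U = 0%N \/ row_full U.
Definition semisimple : Prop :=
  forall n (rho : 'I_d -> 'M[k]_n), is_hmod rho ->
  forall U : 'M[k]_n, stable rho U ->
  exists W : 'M[k]_n, stable rho W /\ \rank (U :&: W)%MS = 0%N /\ row_full (U + W)%MS.

(* H^* = k^d in the dual basis *)
Definition hchar n (rho : 'I_d -> 'M[k]_n) : 'rV[k]_d := \row_a \tr (rho a).
Definition conv (p q : 'rV[k]_d) : 'rV[k]_d :=
  \row_a \sum_(b < d) \sum_(c < d) hD H a b c * p 0 b * q 0 c.
Definition heps : 'rV[k]_d := \row_a he H a.
Definition cpow (p : 'rV[k]_d) (j : nat) : 'rV[k]_d := iter j (fun q => conv q p) heps.
Definition hpair (p x : 'rV[k]_d) : k := \sum_(a < d) p 0 a * x 0 a.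

Definition is_irr_char (p : 'rV[k]_d) : Prop :=
  exists n (rho : 'I_d -> 'M[k]_n), [/\ is_hmod rho, irr_mod rho & p = hchar rho].
Definition inRH (p : 'rV[k]_d) : Prop :=
  exists s : seq (k * 'rV[k]_d),
    (forall x, x \in s -> is_irr_char x.2) /\ p = \sum_(x <- s) x.1 *: x.2.
Definition prim_idem (F : 'rV[k]_d) : Prop :=
  [/\ inRH F, conv F F = F, F != 0,
      (forall q, inRH q -> conv F q = conv q F)
    & forall E, inRH E -> conv E E = E -> conv E F = E -> E = 0 \/ E = F].
Definition dimFH (F : 'rV[k]_d) : nat :=
  \rank (\matrix_(a < d, b < d) (conv F (ebas a)) 0 b).
Definition leftharp (h p : 'rV[k]_d) : 'rV[k]_d :=
  \row_c \sum_(b < d) (hcomul h) b c * p 0 b.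
Definition hEta (Lam F : 'rV[k]_d) : 'rV[k]_d :=
  (dimFH F)%:R^-1 *: leftharp Lam (d%:R *: F).

Definition inLKer n (rho : 'I_d -> 'M[k]_n) (x : 'rV[k]_d) : Prop :=
  forall b : 'I_d, \sum_(c < d) (hcomul x) b c *: rho c = x 0 b *: 1%:M.
Definition faithful_char n (rho : 'I_d -> 'M[k]_n) : Prop :=
  forall x, inLKer rho x <-> exists c : k, x = c *: h1 H.

Definition is_integral (L : 'rV[k]_d) : Prop :=
  forall x, hmul x L = hcounit x *: L /\ hmul L x = hcounit x *: L.
Definition is_dual_integral (l : 'rV[k]_d) : Prop :=
  forall p, conv p l = hpair p (h1 H) *: l /\ conv l p = hpair p (h1 H) *: l.

End HopfDefs.

(* Main.v *)
(** The regular character [chi_reg] satisfies [chi_reg * chi_reg = d chi_reg], and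
    the trace of [y |-> S^2 (p(y_1) y_2)] on [H] is [d <p, Lam>]. Since [S^4 = 1], the
    choice [p = chi_reg / d] shows that [eps(Lam)] is an integer and the choice
    [p = eps] that [tr S^2 = d eps(Lam)]; as [eps(Lam) <> 0] by semisimplicity, [S^2] is
    an involution of trace [+d] or [-d], so [S^2 = 1]. Hence [lam = chi_reg] and left
    multiplication by [p] on [H^*] has trace [d <p, Lam>].

    The form [<pq, Lam>] is nondegenerate on the commutative algebra [R(H)], and a
    nilpotent has trace [0], so [R(H)] is reduced; thus [chi] is a root of the product
    of the [X - a], [a] in [chi(H)], the eigenvalue on a primitive idempotent [F_j]
    being [<chi, eta_j>]. Let [B] be the subalgebra of [H^*] generated by the matrix
    coefficients of [V]. The form is nondegenerate on [B] too, which yields [b] in [B]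
    with [q b = q(1) b] for all [q] in [B]; then [Lam_1 <b, Lam_2>] lies in [LKer_V], so
    faithfulness forces [lam] to be in [B], and every irreducible occurs in some power
    of [chi]. By Perron-Frobenius the eigenvalue [n = chi(1)] of [chi] on [R(H)] is
    simple with eigenvector [lam]. So [lam] is, up to a nonzero factor, the product of
    the [chi - a], [a <> n]: a combination of [chi^j], [j < t], in which every
    irreducible occurs. *)

Require Import Defs.
From HB Require Import structures.
From mathcomp Require Import all_boot all_order all_algebra.
From mathcomp Require Import ring zify mxtens.
From Stdlib Require Import Classical.
Import Order.TTheory GRing.Theory Num.Theory.
Local Open Scope ring_scope.
Set Implicit Arguments. Unset Strict Implicit. Unset Printing Implicit Defensive.

(** * Sweedler sums *)

Section Linear.
Variables (k : fieldType) (d : nat).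
Local Notation V := 'rV[k]_d.

Definition lform (f : V -> k) := forall a x y, f (a *: x + y) = a * f x + f y.
Definition lmap (f : V -> V) :=
  forall a x y, f (a *: x + y) = a *: f x + f y.
(** The condition under which an integrand in the two legs of a coproduct comes from a linear form
    on the tensor square of [V]. *)
Definition bform (F : V -> V -> k) :=
  (forall y, lform (fun x => F x y)) /\ (forall x, lform (F x)).

Lemma lform0 f : lform f -> f 0 = 0.
Proof. by move=> fP; have := fP (-1) 0 0; rewrite scaler0 addr0 mulN1r addNr. Qed.

Lemma lformD f x y : lform f -> f (x + y) = f x + f y.
Proof. by move=> fP; have := fP 1 x y; rewrite scale1r mul1r. Qed.

Lemma lformZ f a x : lform f -> f (a *: x) = a * f x.
Proof. by move=> fP; have := fP a x 0; rewrite (lform0 fP) !addr0. Qed.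

Lemma lform_sum I (r : seq I) P (F : I -> V) f : lform f ->
  f (\sum_(i <- r | P i) F i) = \sum_(i <- r | P i) f (F i).
Proof.
move=> fP; apply: (big_morph f) => [x y|]; [exact: lformD | exact: lform0].
Qed.

Lemma lform_basis f x : lform f -> f x = \sum_a x 0 a * f (ebas k a).
Proof.
move=> fP; rewrite {1}[x]row_sum_delta (lform_sum _ _ _ fP).
by apply: eq_bigr => a _; rewrite (lformZ _ _ fP).
Qed.

Lemma eq_lform f g : lform f -> lform g ->
  (forall a, f (ebas k a) = g (ebas k a)) -> f =1 g.
Proof.
move=> fP gP fg x; rewrite (lform_basis x fP) (lform_basis x gP).
by apply: eq_bigr => a _; rewrite fg.
Qed.

Lemma lmap0 (f : V -> V) : lmap f -> f 0 = 0.
Proof. by move=> fP; have := fP (-1) 0 0; rewrite scaler0 addr0 scaleN1r addNr. Qed.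

Lemma lmapD (f : V -> V) x y : lmap f -> f (x + y) = f x + f y.
Proof. by move=> fP; have := fP 1 x y; rewrite !scale1r. Qed.

Lemma lmapZ (f : V -> V) a x : lmap f -> f (a *: x) = a *: f x.
Proof. by move=> fP; have := fP a x 0; rewrite (lmap0 fP) !addr0. Qed.

Lemma lmapB (f : V -> V) x y : lmap f -> f (x - y) = f x - f y.
Proof. by move=> fP; rewrite -scaleN1r addrC fP scaleN1r addrC. Qed.
Lemma lformB (f : V -> k) x y : lform f -> f (x - y) = f x - f y.
Proof. by move=> fP; rewrite -scaleN1r addrC fP mulN1r addrC. Qed.

Lemma ebasE a b : (ebas k a : V) 0 b = (b == a)%:R.
Proof. by rewrite mxE eqxx. Qed.

Lemma hpairE (p : V) a : hpair p (ebas k a) = p 0 a.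
Proof.
rewrite /hpair (bigD1 a) //= ebasE eqxx mulr1 big1 ?addr0 // => b ba.
by rewrite ebasE (negPf ba) mulr0.
Qed.

Lemma hpairC (p q : V) : hpair p q = hpair q p.
Proof. by apply: eq_bigr => a _; rewrite mulrC. Qed.

Lemma hpair_lform (p : V) : lform (hpair p).
Proof.
move=> a x y; rewrite mulr_sumr -big_split /=; apply: eq_bigr => b _.
by rewrite !mxE; ring.
Qed.

Lemma hpair_lform_l (x : V) : lform (fun p => hpair p x).
Proof. by move=> a p q; rewrite !(hpairC _ x) hpair_lform. Qed.

Lemma eq_hpair (p q : V) : (forall x, hpair p x = hpair q x) -> p = q.
Proof. by move=> pq; apply/rowP => a; rewrite -!hpairE. Qed.

Lemma eq_hpairr (x y : V) : (forall p, hpair p x = hpair p y) -> x = y.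
Proof. by move=> xy; apply: eq_hpair => p; rewrite !(hpairC _ p). Qed.

(** The element of [H^*] behind a form given as a function; it lets identities in [H^*] be applied
    to arbitrary Sweedler integrands. *)
Definition frow (f : V -> k) : V := \row_a f (ebas k a).

Lemma frowE f x : lform f -> hpair (frow f) x = f x.
Proof.
move=> fP; rewrite (lform_basis x fP); apply: eq_bigr => a _.
by rewrite mxE mulrC.
Qed.

Lemma lform_mulr f c : lform f -> lform (fun x => f x * c).
Proof. by move=> fP a x y; rewrite fP; ring. Qed.
Lemma lform_mull f c : lform f -> lform (fun x => c * f x).
Proof. by move=> fP a x y; rewrite fP; ring. Qed.
Lemma lform_comp f g : lform f -> lmap g -> lform (fun x => f (g x)).
Proof. by move=> fP gP a x y; rewrite gP fP. Qed.
Lemma lform_hpair (p : V) g : lmap g -> lform (fun x => hpair p (g x)).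
Proof. exact: lform_comp (hpair_lform p). Qed.
Lemma lform_hpairl (p : V) g : lmap g -> lform (fun x => hpair (g x) p).
Proof. exact: lform_comp (hpair_lform_l p). Qed.
Lemma lmap_id : lmap (fun x : V => x). Proof. by []. Qed.

End Linear.

(** * The Hopf algebra axioms in Sweedler form *)

Section Hopf.
Variables (k : fieldType) (d : nat) (H : hopf k d).
Local Notation V := 'rV[k]_d.
Local Notation "x *h y" := (hmul H x y) (at level 40, left associativity).
Local Notation "p *c q" := (conv H p q) (at level 40, left associativity).
Local Notation ev := hpair.
Local Notation eps := (hcounit H).
Local Notation e_ := (@ebas k d).

(* Sweedler notation: sw x F is F(x_1, x_2). *)
Definition sw (x : V) (F : V -> V -> k) : k :=
  \sum_b \sum_c hcomul H x b c * F (e_ b) (e_ c).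
Definition hant (x : V) : V := \sum_a x 0 a *: hS H a.
Local Notation S := hant.

Lemma hcomul_ebas a : hcomul H (e_ a) = hD H a.
Proof.
rewrite /hcomul (bigD1 a) //= ebasE eqxx scale1r big1 ?addr0 // => b ba.
by rewrite ebasE (negPf ba) scale0r.
Qed.

Lemma hcomul_lin a x y b c :
  hcomul H (a *: x + y) b c = a * hcomul H x b c + hcomul H y b c.
Proof.
rewrite /hcomul !summxE mulr_sumr -big_split /=; apply: eq_bigr => i _.
by rewrite !mxE; ring.
Qed.

Lemma hcounit_lform : lform eps.
Proof.
move=> a x y; rewrite mulr_sumr -big_split /=; apply: eq_bigr => b _.
by rewrite !mxE; ring.
Qed.

Lemma hcounitE x : eps x = ev (heps H) x.
Proof. by apply: eq_bigr => a _; rewrite mxE mulrC. Qed.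

Lemma sw_lform F : lform (fun x => sw x F).
Proof.
move=> a x y; rewrite /sw mulr_sumr -big_split /=; apply: eq_bigr => b _.
rewrite mulr_sumr -big_split /=; apply: eq_bigr => c _.
by rewrite hcomul_lin; ring.
Qed.

Lemma lform_sw g F : lmap g -> lform (fun x => sw (g x) F).
Proof. exact: lform_comp (@sw_lform F). Qed.

Lemma lform_sw_body y (G : V -> V -> V -> k) : (forall a b, lform (fun x => G x a b)) ->
  lform (fun x => sw y (G x)).
Proof.
move=> GP a x x'; rewrite /sw mulr_sumr -big_split /=; apply: eq_bigr => b _.
rewrite mulr_sumr -big_split /=; apply: eq_bigr => c _.
by rewrite GP; ring.
Qed.

Lemma lform_hcounit g : lmap g -> lform (fun x => eps (g x)).
Proof. exact: lform_comp hcounit_lform. Qed.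

Lemma hmul_lin_l y : lmap (fun x => x *h y).
Proof.
move=> a x x'; rewrite /hmul scaler_sumr -big_split /=; apply: eq_bigr => b _.
rewrite scaler_sumr -big_split /=; apply: eq_bigr => c _.
by rewrite !mxE scalerA -scalerDl; congr (_ *: _); ring.
Qed.

Lemma hmul_lin_r x : lmap (fun y => x *h y).
Proof.
move=> a y y'; rewrite /hmul scaler_sumr -big_split /=; apply: eq_bigr => b _.
rewrite scaler_sumr -big_split /=; apply: eq_bigr => c _.
by rewrite !mxE scalerA -scalerDl; congr (_ *: _); ring.
Qed.

Lemma hant_lin : lmap S.
Proof.
move=> a x y; rewrite /hant scaler_sumr -big_split /=; apply: eq_bigr => b _.
by rewrite !mxE scalerA -scalerDl.
Qed.

Lemma lmap_hmull y g : lmap g -> lmap (fun x : V => g x *h y).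
Proof. by move=> gP a x x'; rewrite gP hmul_lin_l. Qed.
Lemma lmap_hmulr y g : lmap g -> lmap (fun x : V => y *h g x).
Proof. by move=> gP a x x'; rewrite gP hmul_lin_r. Qed.
Lemma lmap_hant g : lmap g -> lmap (fun x : V => S (g x)).
Proof. by move=> gP a x x'; rewrite gP hant_lin. Qed.

Lemma sw_ext x F G : F =2 G -> sw x F = sw x G.
Proof. by move=> FG; do 2!apply: eq_bigr => ? _; rewrite FG. Qed.

Lemma swZl x c F : sw x (fun a b => c * F a b) = c * sw x F.
Proof.
rewrite /sw mulr_sumr; apply: eq_bigr => b _; rewrite mulr_sumr.
by apply: eq_bigr => e _; ring.
Qed.

Lemma swZr x c F : sw x (fun a b => F a b * c) = sw x F * c.
Proof. by rewrite mulrC -swZl; apply: sw_ext => a b; rewrite mulrC. Qed.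

Lemma sw_sum I (r : seq I) x (G : I -> V -> V -> k) :
  sw x (fun a b => \sum_(i <- r) G i a b) = \sum_(i <- r) sw x (G i).
Proof.
rewrite /sw [RHS]exchange_big /=; apply: eq_bigr => b _.
by rewrite [RHS]exchange_big /=; apply: eq_bigr => c _; rewrite mulr_sumr.
Qed.

Lemma swC x y F : sw x (fun a b => sw y (F a b))
  = sw y (fun c e => sw x (fun a b => F a b c e)).
Proof.
rewrite [RHS]/sw {2}/sw sw_sum; apply: eq_bigr => b _.
by rewrite sw_sum; apply: eq_bigr => c _; rewrite swZl.
Qed.

Lemma conv_hpair p q x : ev (p *c q) x = sw x (fun a b => ev p a * ev q b).
Proof.
transitivity (\sum_a \sum_b \sum_c x 0 a * hD H a b c * (p 0 b * q 0 c)).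
  apply: eq_bigr => a _; rewrite mxE mulr_suml; apply: eq_bigr => b _.
  by rewrite mulr_suml; apply: eq_bigr => c _; ring.
rewrite exchange_big /=; apply: eq_bigr => b _.
rewrite exchange_big /=; apply: eq_bigr => c _.
rewrite -mulr_suml !hpairE; congr (_ * _).
by rewrite /hcomul summxE; apply: eq_bigr => a _; rewrite mxE.
Qed.

Lemma sw_hpair x b c : hcomul H x b c = sw x (fun a a' => ev (e_ b) a * ev (e_ c) a').
Proof.
rewrite /sw (bigD1 b) //= [X in _ + X]big1 ?addr0 => [|i ib].
  rewrite (bigD1 c) //= big1 ?addr0 => [|j jc].
    by rewrite !hpairE !ebasE !eqxx !mulr1.
  by rewrite !hpairE !ebasE (negPf jc) !mulr0.
by apply: big1 => j _; rewrite !hpairE !ebasE (negPf ib) mul0r mulr0.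
Qed.

Hypothesis HH : is_hopf H.

Lemma hmulA x y z : x *h y *h z = x *h (y *h z). Proof. by case: HH. Qed.
Lemma hmul1l x : h1 H *h x = x. Proof. by case: HH => _ /(_ x) []. Qed.
Lemma hmul1r x : x *h h1 H = x. Proof. by case: HH => _ /(_ x) []. Qed.
Lemma hcounitM x y : eps (x *h y) = eps x * eps y.
Proof. by case: HH => _ _ _ _ [_ [->]]. Qed.
Lemma hcounit1 : eps (h1 H) = 1. Proof. by case: HH => _ _ _ _ [_ [_ ->]]. Qed.

Lemma sw_coassoc x F :
  sw x (fun a b => sw a (fun a1 a2 => F a1 a2 b))
  = sw x (fun a b => sw b (fun b1 b2 => F a b1 b2)).
Proof.
move: x; apply: eq_lform; [exact: sw_lform | exact: sw_lform | move=> a].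
case: HH => _ _ coA _ _; rewrite /sw hcomul_ebas.
transitivity (\sum_p \sum_q \sum_r (\sum_b hD H a b r * hD H b p q) * F (e_ p) (e_ q) (e_ r)).
  under eq_bigr => b _ do under eq_bigr => r _ do rewrite mulr_sumr hcomul_ebas.
  rewrite exchange_big /=.
  under eq_bigr => r _ do rewrite exchange_big /=.
  rewrite exchange_big /=; apply: eq_bigr => p _.
  under eq_bigr => r _ do under eq_bigr => b _ do rewrite mulr_sumr.
  under eq_bigr => r _ do rewrite exchange_big /=.
  rewrite exchange_big /=; apply: eq_bigr => q _.
  apply: eq_bigr => r _; rewrite mulr_suml; apply: eq_bigr => b _; ring.
apply: eq_bigr => p _.
under [RHS]eq_bigr => b _ do rewrite mulr_sumr hcomul_ebas.
rewrite [RHS]exchange_big /=; apply: eq_bigr => q _.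
under [RHS]eq_bigr => b _ do rewrite mulr_sumr.
rewrite [RHS]exchange_big /=; apply: eq_bigr => r _.
by rewrite coA mulr_suml; apply: eq_bigr => b _; ring.
Qed.

Lemma sw_counitl x f : lform f -> sw x (fun a b => eps a * f b) = f x.
Proof.
move=> fP; move: x; apply: eq_lform => //; first exact: sw_lform.
move=> a; rewrite /sw hcomul_ebas; case: HH => _ _ _ coU _.
rewrite exchange_big /=.
transitivity (\sum_c (a == c)%:R * f (e_ c)).
  apply: eq_bigr => c _; rewrite -(proj1 (coU a c)) mulr_suml.
  by apply: eq_bigr => b _; rewrite mulrA hcounitE hpairE mxE.
by rewrite (bigD1 a) //= eqxx mul1r big1 ?addr0 // => c ca; rewrite eq_sym (negPf ca) mul0r.
Qed.

Lemma sw_counitr x f : lform f -> sw x (fun a b => f a * eps b) = f x.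
Proof.
move=> fP; move: x; apply: eq_lform => //; first exact: sw_lform.
move=> a; rewrite /sw hcomul_ebas; case: HH => _ _ _ coU _.
transitivity (\sum_c (a == c)%:R * f (e_ c)).
  apply: eq_bigr => c _; rewrite -(proj2 (coU a c)) mulr_suml.
  by apply: eq_bigr => b _; rewrite hcounitE hpairE mxE; ring.
by rewrite (bigD1 a) //= eqxx mul1r big1 ?addr0 // => c ca; rewrite eq_sym (negPf ca) mul0r.
Qed.

(** [sw] evaluates [F] on basis vectors, but the products on the right are not basis vectors;
    bilinearity of [F] bridges the two. *)
Lemma sw_mul x y F : bform F ->
  sw (x *h y) F = sw x (fun a b => sw y (fun c e => F (a *h c) (b *h e))).
Proof.
case=> Fl Fr; case: HH => _ _ _ _ [[dM _] _ _].
rewrite {1}/sw dM.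
transitivity (\sum_u \sum_v \sum_p \sum_q \sum_r \sum_s
   hcomul H x p q * (hcomul H y r s * (hm H p r 0 u * hm H q s 0 v * F (e_ u) (e_ v)))).
  apply: eq_bigr => u _; apply: eq_bigr => v _; rewrite mxE mulr_suml.
  apply: eq_bigr => p _; rewrite mulr_suml; apply: eq_bigr => q _.
  rewrite mulr_suml; apply: eq_bigr => r _; rewrite mulr_suml.
  by apply: eq_bigr => s _; ring.
under eq_bigr => u _ do rewrite exchange_big /=.
rewrite exchange_big /=; apply: eq_bigr => p _.
under eq_bigr => u _ do rewrite exchange_big /=.
rewrite exchange_big /=; apply: eq_bigr => q _.
under eq_bigr => u _ do rewrite exchange_big /=.
rewrite exchange_big /= /sw mulr_sumr; apply: eq_bigr => r _.
under eq_bigr => u _ do rewrite exchange_big /=.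
rewrite exchange_big /= mulr_sumr; apply: eq_bigr => s _.
have hme a b : e_ a *h e_ b = hm H a b.
  rewrite /hmul (bigD1 a) //= [X in _ + X]big1 ?addr0 => [|i ia].
    rewrite (bigD1 b) //= big1 ?addr0 => [|i ib]; rewrite !ebasE !eqxx ?mulr1 ?scale1r //.
    by rewrite (negPf ib) mulr0 scale0r.
  by apply: big1 => j _; rewrite !ebasE (negPf ia) mul0r scale0r.
rewrite !hme (lform_basis (hm H p r) (Fl _)).
under eq_bigr => u _ do under eq_bigr => v _ do rewrite mulrA.
transitivity (hcomul H x p q * hcomul H y r s *
  \sum_u \sum_v (hm H p r 0 u * hm H q s 0 v * F (e_ u) (e_ v))).
  by rewrite mulr_sumr; apply: eq_bigr => u _; rewrite mulr_sumr.
rewrite -mulrA; congr (_ * (_ * _)); apply: eq_bigr => u _.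
rewrite (lform_basis (hm H q s) (Fr _)) mulr_sumr.
by apply: eq_bigr => v _; ring.
Qed.

Lemma sw_antipodel x f : lform f -> sw x (fun a b => f (S a *h b)) = eps x * f (h1 H).
Proof.
move=> fP; move: x; apply: eq_lform; first exact: sw_lform.
  exact/lform_mulr/hcounit_lform.
move=> a; rewrite hcounitE hpairE mxE -(lformZ _ _ fP).
case: HH => _ _ _ _ [_ _ /(_ a) [<- _]].
rewrite /sw hcomul_ebas (lform_sum _ _ _ fP); apply: eq_bigr => b _.
rewrite (lform_sum _ _ _ fP); apply: eq_bigr => c _.
rewrite (lformZ _ _ fP); congr (_ * f (_ *h _)).
rewrite /hant (bigD1 b) //= ebasE eqxx scale1r big1 ?addr0 // => i ib.
by rewrite ebasE (negPf ib) scale0r.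
Qed.

Lemma sw_antipoder x f : lform f -> sw x (fun a b => f (a *h S b)) = eps x * f (h1 H).
Proof.
move=> fP; move: x; apply: eq_lform; first exact: sw_lform.
  exact/lform_mulr/hcounit_lform.
move=> a; rewrite hcounitE hpairE mxE -(lformZ _ _ fP).
case: HH => _ _ _ _ [_ _ /(_ a) [_ <-]].
rewrite /sw hcomul_ebas (lform_sum _ _ _ fP); apply: eq_bigr => b _.
rewrite (lform_sum _ _ _ fP); apply: eq_bigr => c _.
rewrite (lformZ _ _ fP); congr (_ * f (_ *h _)).
rewrite /hant (bigD1 c) //= ebasE eqxx scale1r big1 ?addr0 // => i ib.
by rewrite ebasE (negPf ib) scale0r.
Qed.

End Hopf.

(** * Integrals and the antipode *)

Lemma lform_bforml (k : fieldType) d (F : 'rV[k]_d -> 'rV[k]_d -> k) g y :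
  bform F -> lmap g -> lform (fun x => F (g x) y).
Proof. by case=> Fl _; apply: lform_comp (Fl y). Qed.
Lemma lform_bformr (k : fieldType) d (F : 'rV[k]_d -> 'rV[k]_d -> k) g y :
  bform F -> lmap g -> lform (fun x => F y (g x)).
Proof. by case=> _ Fr; apply: lform_comp (Fr y). Qed.
(** Linearity side conditions follow from the shape of the term, one operation being peeled off at a
    time. *)
Ltac lin :=
  repeat first
  [ assumption
  | exact: lmap_id
  | match goal with |- bform _ => split => ? /= end
  | match goal with |- forall _, _ => move=> ? end
  | match goal with |- lmap (fun x => x) => exact: lmap_id end
  | apply: lform_hpair | apply: lform_hpairl
  | apply: lform_hcounit
  | apply: lform_mulr | apply: lform_mull
  | apply: lform_sw | apply: lform_sw_body
  | apply: lmap_hmull | apply: lmap_hmulr | apply: lmap_hant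
  | apply: lform_bforml | apply: lform_bformr
  | apply: lform_comp ].

Section Integrals.
Variables (k : fieldType) (d : nat) (H : hopf k d).
Local Notation V := 'rV[k]_d.
Local Notation "x *h y" := (hmul H x y) (at level 40, left associativity).
Local Notation "p *c q" := (conv H p q) (at level 40, left associativity).
Local Notation ev := hpair.
Local Notation eps := (hcounit H).
Local Notation e_ := (@ebas k d).
Local Notation S := (hant H).
Local Notation sw := (sw H).

Hypothesis HH : is_hopf H.
Variables Lam lam : V.
Hypotheses (HLam : is_integral H Lam) (Hlam : is_dual_integral H lam).
Hypothesis lamLam : ev lam Lam = 1.

(** The identity [p lam = p(1) lam] in [H^*], read on elements: [x_1 <lam, x_2> = <lam, x> 1]. *)
Lemma sw_lamr x f : lform f -> sw x (fun a b => f a * ev lam b) = f (h1 H) * ev lam x.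
Proof.
move=> fP; rewrite -(frowE (h1 H) fP) -(lformZ _ _ (hpair_lform_l x)).
rewrite -(proj1 (Hlam (frow f))) conv_hpair.
by apply: sw_ext => a b; rewrite frowE.
Qed.

Lemma sw_laml x f : lform f -> sw x (fun a b => ev lam a * f b) = f (h1 H) * ev lam x.
Proof.
move=> fP; rewrite -(frowE (h1 H) fP) -(lformZ _ _ (hpair_lform_l x)).
rewrite -(proj2 (Hlam (frow f))) conv_hpair.
by apply: sw_ext => a b; rewrite frowE.
Qed.

(** Insert [S(h_1) h_2] in the first leg: in [S(h_1) h_2 Lam_1 (x) h_3 Lam_2] the last two factors
    of [h] act through the coproduct of [h_2 Lam = eps(h_2) Lam]. *)
Lemma sw_Lam_mulr h F : bform F ->
  sw Lam (fun a b => F a (h *h b)) = sw Lam (fun a b => F (S h *h a) b).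
Proof.
move=> FP; rewrite -[LHS](sw_counitl HH h (f := fun h => sw Lam (fun a b => F a (h *h b)))); last by lin.
transitivity (sw h (fun h1 h2 => sw h1 (fun u v =>
   sw Lam (fun a b => F (S u *h v *h a) (h2 *h b))))).
  apply: sw_ext => h1 h2.
  rewrite (sw_antipodel HH h1 (f := fun z => sw Lam (fun a b => F (z *h a) (h2 *h b)))); last by lin.
  by congr (_ * _); apply: sw_ext => a b; rewrite hmul1l.
rewrite (sw_coassoc HH h (fun u v h2 => sw Lam (fun a b => F (S u *h v *h a) (h2 *h b)))).
rewrite -(sw_counitr HH h (f := fun h => sw Lam (fun a b => F (S h *h a) b))); last by lin.
apply: sw_ext => u w.
transitivity (sw (w *h Lam) (fun a b => F (S u *h a) b)).
  rewrite (sw_mul HH) //; last by lin.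
  by do 2!apply: sw_ext => ? ?; rewrite (hmulA HH).
by rewrite (proj1 (HLam w)) (lformZ _ _ (sw_lform _ _)) mulrC.
Qed.

(** Mirror image: [h_2 S(h_3)] is inserted in the second leg and [Lam h = eps(h) Lam] is used. *)
Lemma sw_Lam_mull h F : bform F ->
  sw Lam (fun a b => F (a *h h) b) = sw Lam (fun a b => F a (b *h S h)).
Proof.
move=> FP; rewrite -[LHS](sw_counitr HH h (f := fun h => sw Lam (fun a b => F (a *h h) b))); last by lin.
transitivity (sw h (fun h1 h2 => sw h2 (fun u v =>
   sw Lam (fun a b => F (a *h h1) (b *h (u *h S v)))))).
  apply: sw_ext => h1 h2.
  rewrite (sw_antipoder HH h2 (f := fun z => sw Lam (fun a b => F (a *h h1) (b *h z)))); last by lin.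
  by rewrite mulrC; congr (_ * _); apply: sw_ext => a b; rewrite hmul1r.
rewrite -(sw_coassoc HH h (fun x u v => sw Lam (fun a b => F (a *h x) (b *h (u *h S v))))).
rewrite -(sw_counitl HH h (f := fun h => sw Lam (fun a b => F a (b *h S h)))); last by lin.
apply: sw_ext => w v.
transitivity (sw (Lam *h w) (fun a b => F a (b *h S v))).
  rewrite (sw_mul HH) //; last by lin.
  by rewrite swC; do 2!apply: sw_ext => ? ?; rewrite -(hmulA HH).
by rewrite (proj2 (HLam w)) (lformZ _ _ (sw_lform _ _)).
Qed.

(** The dual exchange rule. Expanding [<lam, x y_1> 1] as [<lam, x_1 y_1> x_2 y_2] leaves
    [y_2 S(y_3)], which collapses. *)
Lemma sw_lam_mul x y g : lform g ->
  sw x (fun a b => ev lam (a *h y) * g b) = sw y (fun a b => ev lam (x *h a) * g (S b)).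
Proof.
move=> gP; symmetry.
transitivity (sw y (fun y1 y2 => sw x (fun a b => sw y1 (fun c e =>
   ev lam (a *h c) * g (b *h e *h S y2))))).
  apply: sw_ext => y1 y2.
  rewrite -(sw_mul HH x y1 (F := fun a b => ev lam a * g (b *h S y2))); last by lin.
  by rewrite (sw_laml _ (f := fun b => g (b *h S y2))) ?(hmul1l HH) 1?mulrC //; lin.
rewrite swC; apply: sw_ext => a b.
rewrite (sw_coassoc HH y (fun c e y2 => ev lam (a *h c) * g (b *h e *h S y2))).
rewrite -(sw_counitr HH y (f := fun y => ev lam (a *h y) * g b)); last by lin.
apply: sw_ext => c w.
transitivity (sw w (fun e y2 => ev lam (a *h c) * g (b *h (e *h S y2)))).
  by apply: sw_ext => ? ?; rewrite (hmulA HH).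
rewrite (sw_antipoder HH w (f := fun z => ev lam (a *h c) * g (b *h z))); last by lin.
by rewrite (hmul1r HH) mulrC.
Qed.

(** The antipode in terms of integrals, [S(y) = <lam, Lam_1 y> Lam_2]. The properties of [S] below
    are read off from this formula. *)
Lemma hantE y g : lform g -> sw Lam (fun a b => ev lam (a *h y) * g b) = g (S y).
Proof.
move=> gP; rewrite sw_lam_mul // -(sw_counitl HH y (f := fun y => g (S y))); last by lin.
apply: sw_ext => a b.
by rewrite (proj2 (HLam a)) (lformZ _ _ (hpair_lform lam)) lamLam mulr1.
Qed.

Lemma hantE' u f : lform f -> sw Lam (fun a b => f a * ev lam (u *h b)) = f (S u).
Proof.
move=> fP; rewrite (sw_Lam_mulr u (F := fun a b => f a * ev lam b)); last by lin.
by rewrite (sw_lamr _ (f := fun a => f (S u *h a))) ?(hmul1r HH) ?lamLam ?mulr1 //; lin.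
Qed.

(** [y = Lam_1 <lam, Lam_2 S(y)>]: the legs of [Lam] provide dual bases, which serve to compute
    traces and to prove nondegeneracy. *)
Lemma hantK_sw y f : lform f -> sw Lam (fun a b => f a * ev lam (b *h S y)) = f y.
Proof.
move=> fP; rewrite -(sw_Lam_mull y (F := fun a b => f a * ev lam b)); last by lin.
by rewrite (sw_lamr _ (f := fun a => f (a *h y))) ?(hmul1l HH) ?lamLam ?mulr1 //; lin.
Qed.

Lemma hantK_sw' y f : lform f -> sw Lam (fun a b => ev lam (S y *h a) * f b) = f y.
Proof.
move=> fP; rewrite -(sw_Lam_mulr y (F := fun a b => ev lam a * f b)); last by lin.
by rewrite (sw_laml _ (f := fun a => f (y *h a))) ?(hmul1r HH) ?lamLam ?mulr1 //; lin.
Qed.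

(** [<lam, Lam_1 x y> Lam_2 = <lam, Lam_1 y> Lam_2 S(x)] by the exchange rule for [Lam]. *)
Lemma hantM x y : S (x *h y) = S y *h S x.
Proof.
apply: eq_hpairr => g; rewrite -(hantE _ (hpair_lform g)).
rewrite -(hantE y (g := fun b => ev g (b *h S x))); last by lin.
rewrite -(sw_Lam_mull x (F := fun a b => ev lam (a *h y) * ev g b)); last by lin.
by apply: sw_ext => a b; rewrite (hmulA HH).
Qed.

Lemma hant1 : S (h1 H) = h1 H.
Proof.
apply: eq_hpairr => g; rewrite -(hantE _ (hpair_lform g)).
transitivity (sw Lam (fun a b => ev lam a * ev g b)).
  by apply: sw_ext => a b; rewrite (hmul1r HH).
by rewrite sw_laml ?lamLam ?mulr1 //; lin.
Qed.

Lemma ev_lamS y : ev lam (S y) = ev lam y.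
Proof.
rewrite -(hantE _ (hpair_lform lam)) (sw_lamr _ (f := fun a => ev lam (a *h y))); last by lin.
by rewrite (hmul1l HH) lamLam mulr1.
Qed.

Lemma hcounitS y : eps (S y) = eps y.
Proof.
rewrite -(hantE _ (@hcounit_lform _ _ H)).
rewrite (sw_counitr HH _ (f := fun a => ev lam (a *h y))); last by lin.
by rewrite (proj2 (HLam y)) (lformZ _ _ (hpair_lform lam)) lamLam mulr1.
Qed.

(** Split [Lam_2] in [<lam, Lam_1 y> Lam_2] by coassociativity; [sw_lam_mul] turns the inner
    coproduct into [S(y_2)], and [hantE] turns the rest into [S(y_1)]. *)
Lemma sw_hant y F : bform F -> sw (S y) F = sw y (fun a b => F (S b) (S a)).
Proof.
move=> FP; rewrite -(hantE y (g := fun z => sw z F)); last by lin.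
transitivity (sw Lam (fun a b => sw b (fun b1 b2 => ev lam (a *h y) * F b1 b2))).
  by apply: sw_ext => a b; rewrite swZl.
rewrite -(sw_coassoc HH Lam (fun a b1 b2 => ev lam (a *h y) * F b1 b2)).
transitivity (sw Lam (fun a b2 => sw y (fun y1 y2 => ev lam (a *h y1) * F (S y2) b2))).
  apply: sw_ext => a b2; rewrite (sw_lam_mul a y (g := fun b1 => F b1 b2)) //.
  by lin.
rewrite swC; apply: sw_ext => y1 y2.
by rewrite (hantE y1 (g := fun b => F (S y2) b)) //; lin.
Qed.

(** Both sides equal [<lam, Lam_1 y> <lam, u Lam_2>]. *)
Lemma ev_lam_hant u y : ev lam (S u *h y) = ev lam (u *h S y).
Proof.
rewrite -(hantE' u (f := fun a => ev lam (a *h y))); last by lin.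
by rewrite -(hantE y (g := fun b => ev lam (u *h b))); last by lin.
Qed.

(** The Nakayama automorphism of the Frobenius form [lam] is the square of the antipode. *)
Lemma ev_lam_swap y u : ev lam (y *h u) = ev lam (u *h S (S y)).
Proof. by rewrite -ev_lam_hant -ev_lamS hantM. Qed.

Lemma ev_lam_nondeg w : (forall x, ev lam (x *h w) = 0) -> w = 0.
Proof.
move=> w0; apply: eq_hpairr => p; rewrite (lform0 (hpair_lform p)).
have Sw : S w = 0.
  apply: eq_hpairr => q; rewrite (lform0 (hpair_lform q)) -(hantE _ (hpair_lform q)).
  by rewrite /sw big1 // => b _; rewrite big1 // => c _; rewrite w0 mul0r mulr0.
rewrite -(hantK_sw _ (hpair_lform p)) Sw.
rewrite /sw big1 // => b _; rewrite big1 // => c _.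
by rewrite (lmap0 (hmul_lin_r H _)) (lform0 (hpair_lform _)) !mulr0.
Qed.

(** Since [lam] is invariant under [S], the Nakayama identity also holds with the factors reversed:
    [<lam, x y> = <lam, S^2(y) x> = <lam, x S^4(y)>]. Nondegeneracy concludes. *)
Lemma hant4 y : S (S (S (S y))) = y.
Proof.
apply/eqP; rewrite -subr_eq0; apply/eqP; apply: ev_lam_nondeg => x.
rewrite (lmapB _ _ (hmul_lin_r H x)) (lformB _ _ (hpair_lform lam)).
apply/eqP; rewrite subr_eq0; apply/eqP.
by rewrite -[RHS]ev_lamS hantM [RHS]ev_lam_swap -hantM ev_lamS [RHS]ev_lam_swap.
Qed.

(** Convolution by [p] from the left is the transpose of [y |-> leftharp H y p], so both have the
    same trace and rank. *)
Lemma ev_leftharp y p q : ev q (leftharp H y p) = ev (p *c q) y.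
Proof.
rewrite conv_hpair /sw exchange_big; apply: eq_bigr => c _ /=.
rewrite mxE mulr_sumr; apply: eq_bigr => b _; rewrite !hpairE; ring.
Qed.

Lemma leftharp_lin p : lmap (fun y => leftharp H y p).
Proof.
move=> a x y; apply: eq_hpairr => q.
by rewrite ev_leftharp !(lformD, lformZ) ?ev_leftharp //; lin.
Qed.

Lemma sw_leftharp y p f : lform f -> f (leftharp H y p) = sw y (fun a b => ev p a * f b).
Proof.
move=> fP; rewrite -(frowE _ fP) ev_leftharp conv_hpair.
by apply: sw_ext => a b; rewrite frowE.
Qed.

Definition trl (f : V -> V) : k := \sum_a f (e_ a) 0 a.

(** The trace computed in the dual bases of [hantK_sw]. *)
Lemma trlE f : lmap f -> trl f = sw Lam (fun a b => ev lam (b *h S (f a))).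
Proof.
move=> fP; rewrite /trl.
under eq_bigr => a _ do rewrite -hpairE hpairC -(hantK_sw _ (hpair_lform (e_ a))).
rewrite -sw_sum; apply: sw_ext => a b.
rewrite (lform_basis a (f := fun a => ev lam (b *h S (f a)))); last first.
  by apply: lform_hpair; apply: lmap_hmulr; apply: lmap_hant.
by apply: eq_bigr => c _; rewrite hpairC hpairE.
Qed.

(** The dual-basis formula gives [<p, Lam_1> <lam, Lam_3 S^3(Lam_2)>]; the Nakayama identity turns
    the second factor into [<lam, S(Lam_2) Lam_3>], where the antipode axiom applies. *)
Lemma trl_leftharpSS p : trl (fun y => S (S (leftharp H y p))) = ev lam (h1 H) * ev p Lam.
Proof.
rewrite trlE; last by do 2!apply: lmap_hant; apply: leftharp_lin.
transitivity (sw Lam (fun a b => sw a (fun a1 a2 => ev p a1 * ev lam (S a2 *h b)))).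
  apply: sw_ext => a b.
  rewrite (sw_leftharp _ _ (f := fun z => ev lam (b *h S (S (S z))))); last by lin.
  by apply: sw_ext => a1 a2; rewrite -ev_lam_swap.
rewrite (sw_coassoc HH Lam (fun a1 a2 b => ev p a1 * ev lam (S a2 *h b))).
rewrite mulrC -(sw_counitr HH Lam (hpair_lform p)) -swZr; apply: sw_ext => a1 w.
rewrite swZl (sw_antipodel HH w (hpair_lform lam)); ring.
Qed.

End Integrals.

(** * Traces and the regular representation *)

Section Traces.
Variable k : fieldType.

Lemma base_inj d (A : 'M[k]_d) (X Y : 'M_(\rank A)) :
  col_base A *m X *m row_base A = col_base A *m Y *m row_base A -> X = Y.
Proof.
move/(row_free_inj (row_base_free A)) => /(congr1 trmx).
rewrite (trmx_mul _ X) (trmx_mul _ Y) => E; apply/trmx_inj.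
have colF : row_free (col_base A)^T by rewrite /row_free mxrank_tr; exact: col_base_full.
exact: (row_free_inj colF) E.
Qed.

(** If [A = C R] is a full-rank factorization, [C R C R = C R] can be cancelled on both sides. The
    same factorization later gives coordinates on the image of an idempotent. *)
Lemma base_idem d (A : 'M[k]_d) : A *m A = A -> row_base A *m col_base A = 1%:M.
Proof.
by move=> AA; apply: base_inj; rewrite mulmx1 mulmxA -mulmxA !mulmx_base.
Qed.

Lemma mxtrace_idem d (A : 'M[k]_d) : A *m A = A -> \tr A = (\rank A)%:R.
Proof.
by move=> AA; rewrite -{1}(mulmx_base A) mxtrace_mulC (base_idem AA) mxtrace1.
Qed.

Lemma mxtrace_sqr0 d (A : 'M[k]_d) : A *m A = 0 -> \tr A = 0.
Proof.
move=> AA; rewrite -(mulmx_base A) mxtrace_mulC.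
suff -> : row_base A *m col_base A = 0 by rewrite mxtrace0.
by apply: base_inj; rewrite mulmx0 mul0mx mulmxA -mulmxA !mulmx_base.
Qed.

Hypothesis Hk : [pchar k] =i pred0.

Lemma natr_eq0 n : (n%:R == 0 :> k) = (n == 0)%N.
Proof. by move/pcharf0P: Hk. Qed.

Lemma natr_inj m n : m%:R = n%:R :> k -> m = n.
Proof.
wlog le_mn : m n / (m <= n)%N.
  by move=> W; case: (leqP m n) => [|/ltnW] mn E; [apply: W | apply/esym/W].
move=> E; have: (n - m)%:R == 0 :> k by rewrite natrB // E subrr.
by rewrite natr_eq0; lia.
Qed.

Lemma two_neq0 : 2%:R != 0 :> k. Proof. by rewrite natr_eq0. Qed.

(** [P] and [Q] are the projections onto the eigenspaces for [1] and [-1], with [M = P - Q] and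
    [M^2 = P + Q]. *)
Lemma mxtrace_tripotent d (M : 'M[k]_d) : M *m M *m M = M ->
  let P := 2%:R^-1 *: (M *m M + M) in let Q := 2%:R^-1 *: (M *m M - M) in
  \tr M = (\rank P)%:R - (\rank Q)%:R /\ \tr (M *m M) = (\rank P)%:R + (\rank Q)%:R.
Proof.
move=> M3 P Q; have M4 : M *m M *m (M *m M) = M *m M by rewrite mulmxA M3.
have M3' : M *m (M *m M) = M by rewrite mulmxA.
have h : 2%:R^-1 * 2%:R^-1 * 2%:R = 2%:R^-1 :> k by field; rewrite two_neq0.
have PP : P *m P = P.
  rewrite /P -scalemxAl -scalemxAr scalerA mulmxDl !mulmxDr M4 M3 M3'.
  by apply/matrixP => i j; rewrite !mxE; field; rewrite two_neq0.
have QQ : Q *m Q = Q.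
  rewrite /Q -scalemxAl -scalemxAr scalerA mulmxBl !mulmxBr M4 M3 M3'.
  by apply/matrixP => i j; rewrite !mxE; field; rewrite two_neq0.
rewrite -(mxtrace_idem PP) -(mxtrace_idem QQ) !mxtraceZ mxtraceD raddfB /=.
by split; field; rewrite two_neq0.
Qed.

End Traces.

Section Regular.
Variables (k : fieldType) (d : nat) (H : hopf k d).
Local Notation V := 'rV[k]_d.
Local Notation "x *h y" := (hmul H x y) (at level 40, left associativity).
Local Notation "p *c q" := (conv H p q) (at level 40, left associativity).
Local Notation ev := hpair.
Local Notation eps := (hcounit H).
Local Notation e_ := (@ebas k d).
Local Notation S := (hant H).
Local Notation sw := (sw H).

Lemma act_lin n (rho : 'I_d -> 'M[k]_n) a x y :
  act rho (a *: x + y) = a *: act rho x + act rho y.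
Proof.
rewrite /act scaler_sumr -big_split /=; apply: eq_bigr => i _.
by rewrite !mxE scalerA -scalerDl.
Qed.

Lemma act_ebas n (rho : 'I_d -> 'M[k]_n) a : act rho (e_ a) = rho a.
Proof.
rewrite /act (bigD1 a) //= ebasE eqxx scale1r big1 ?addr0 // => b ba.
by rewrite ebasE (negPf ba) scale0r.
Qed.

Lemma hcharE n (rho : 'I_d -> 'M[k]_n) x : ev (hchar rho) x = \tr (act rho x).
Proof.
rewrite /act raddf_sum; apply: eq_bigr => a _ /=.
by rewrite mxE mxtraceZ mulrC.
Qed.

Definition lreg (a : 'I_d) : 'M[k]_d := \matrix_(i, j) (e_ a *h e_ j) 0 i.

Lemma act_lreg x y : y *m (act lreg x)^T = x *h y.
Proof.
apply: eq_hpair => p.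
have L1 : lform (fun y => ev (y *m (act lreg x)^T) p).
  by move=> a u v; rewrite mulmxDl -scalemxAl hpair_lform_l.
move: y; apply: eq_lform => //; first by lin.
move=> b; move: x {L1}; apply: eq_lform.
- move=> a u v; rewrite act_lin linearD linearZ mulmxDr -scalemxAr.
  exact: hpair_lform_l.
- by lin.
move=> a; rewrite act_ebas; congr hpair; apply/rowP => i.
by rewrite /ebas -rowE !mxE.
Qed.

Lemma mxtrace_lreg x : \tr (act lreg x) = trl (fun y => x *h y).
Proof.
by rewrite -mxtrace_tr /mxtrace /trl; apply: eq_bigr => a _; rewrite -act_lreg /ebas -rowE [RHS]mxE.
Qed.

(** Matrices act on row vectors here, so a product of matrices applies its left factor first. *)
Definition mxl (f : V -> V) : 'M[k]_d := \matrix_(a, b) f (e_ a) 0 b.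

Lemma mxlE f x : lmap f -> x *m mxl f = f x.
Proof.
move=> fP; apply: eq_hpairr => p.
move: x; apply: eq_lform; last first.
- by move=> a; congr (ev p _); apply/rowP => i; rewrite /ebas -rowE !mxE.
- by lin.
by move=> a u v; rewrite mulmxDl -scalemxAl hpair_lform.
Qed.

Lemma mxl_inj (A B : 'M[k]_d) : (forall x : V, x *m A = x *m B) -> A = B.
Proof. by move=> AB; apply/row_matrixP => i; rewrite !rowE AB. Qed.

Lemma mxl_comp f g : lmap f -> lmap g -> mxl f *m mxl g = mxl (fun x => g (f x)).
Proof.
move=> fP gP; apply: mxl_inj => x; rewrite mulmxA !mxlE //.
by move=> a u v; rewrite fP gP.
Qed.

Lemma mxtrace_mxl f : \tr (mxl f) = trl f.
Proof. by rewrite /mxtrace /trl; apply: eq_bigr => a _; rewrite mxE. Qed.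

Hypothesis HH : is_hopf H.

Lemma lreg_mod : is_hmod H lreg.
Proof.
split=> [x y|].
  apply/trmx_inj/mxl_inj => z.
  by rewrite trmx_mul mulmxA !act_lreg (hmulA HH).
by apply/trmx_inj/mxl_inj => z; rewrite act_lreg (hmul1l HH) trmx1 mulmx1.
Qed.

Lemma convA p q r : p *c (q *c r) = p *c q *c r.
Proof.
apply: eq_hpair => x; rewrite !conv_hpair.
transitivity (sw x (fun a b => sw b (fun b1 b2 => ev p a * ev q b1 * ev r b2))).
  by apply: sw_ext => a b; rewrite conv_hpair -swZl; apply: sw_ext => ? ?; rewrite mulrA.
rewrite -(sw_coassoc HH x (fun a b1 b2 => ev p a * ev q b1 * ev r b2)).
by apply: sw_ext => a b; rewrite conv_hpair -swZr.
Qed.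

Lemma conv1l p : heps H *c p = p.
Proof.
apply: eq_hpair => x; rewrite conv_hpair -[RHS](sw_counitl HH x (hpair_lform p)).
by apply: sw_ext => a b; rewrite hcounitE.
Qed.

Lemma conv1r p : p *c heps H = p.
Proof.
apply: eq_hpair => x; rewrite conv_hpair -[RHS](sw_counitr HH x (hpair_lform p)).
by apply: sw_ext => a b; rewrite hcounitE.
Qed.

Lemma conv_linl q : lmap (fun p => p *c q).
Proof.
move=> a p p'; apply: eq_hpair => x; rewrite hpair_lform_l !conv_hpair -swZl.
rewrite /sw -big_split; apply: eq_bigr => b _ /=.
rewrite -big_split; apply: eq_bigr => c _ /=.
by rewrite hpair_lform_l; ring.
Qed.

Lemma conv_linr q : lmap (fun p => q *c p).
Proof.
move=> a p p'; apply: eq_hpair => x; rewrite hpair_lform_l !conv_hpair -swZl.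
rewrite /sw -big_split; apply: eq_bigr => b _ /=.
rewrite -big_split; apply: eq_bigr => c _ /=.
by rewrite hpair_lform_l; ring.
Qed.

Lemma conv_ev1 p q : ev (p *c q) (h1 H) = ev p (h1 H) * ev q (h1 H).
Proof.
case: (HH) => _ _ _ _ [[_ D1] _ _].
rewrite conv_hpair /sw D1 [in RHS]/hpair mulr_suml; apply: eq_bigr => b _.
rewrite mulr_sumr; apply: eq_bigr => c _.
by rewrite !hpairE [_ b c]mxE big_ord1 mxE; ring.
Qed.

Lemma hchar1 n (rho : 'I_d -> 'M[k]_n) : is_hmod H rho -> ev (hchar rho) (h1 H) = n%:R.
Proof. by case=> _ r1; rewrite hcharE r1 mxtrace1. Qed.

Lemma hchar_traceC n (rho : 'I_d -> 'M[k]_n) x y : is_hmod H rho ->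
  ev (hchar rho) (x *h y) = ev (hchar rho) (y *h x).
Proof. by case=> rM _; rewrite !hcharE !rM mxtrace_mulC. Qed.

(** The character form of the fact that the regular module tensored with [V] is a sum of [dim V]
    copies of the regular module, for any trace form [q] in place of the character of [V]. *)
Lemma hchar_lreg_conv q : (forall x y, ev q (x *h y) = ev q (y *h x)) ->
  hchar lreg *c q = ev q (h1 H) *: hchar lreg.
Proof.
move=> qC; apply: eq_hpair => x; rewrite (lformZ _ _ (hpair_lform_l x)).
rewrite conv_hpair hcharE mxtrace_lreg.
transitivity (\sum_i sw x (fun a b => ev (e_ i) (a *h e_ i) * ev q b)).
  rewrite -sw_sum; apply: sw_ext => a b; rewrite hcharE mxtrace_lreg mulr_suml.
  by apply: eq_bigr => i _; rewrite [ev (e_ i) _]hpairC hpairE.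
(* With [y = e_i], insert [y_2 S(y_3)] after [x_2]; the legs then regroup into the coproduct of
   [x y_1]. *)
transitivity (\sum_i sw (e_ i) (fun y v => sw (x *h y) (fun s t =>
    ev (e_ i) s * ev q (t *h S v)))).
  apply: eq_bigr => i _.
  transitivity (sw x (fun a b => sw (e_ i) (fun c w => sw w (fun u v =>
      ev (e_ i) (a *h c) * ev q (b *h (u *h S v)))))).
    apply: sw_ext => a b.
    rewrite -(sw_counitr HH (e_ i) (f := fun y => ev (e_ i) (a *h y) * ev q b)); last by lin.
    apply: sw_ext => c w.
    rewrite (sw_antipoder HH w (f := fun z => ev (e_ i) (a *h c) * ev q (b *h z))); last by lin.
    by rewrite (hmul1r HH) mulrC.
  transitivity (sw x (fun a b => sw (e_ i) (fun y v => sw y (fun c u =>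
      ev (e_ i) (a *h c) * ev q (b *h (u *h S v)))))).
    apply: sw_ext => a b.
    by rewrite (sw_coassoc HH (e_ i) (fun c u v => ev (e_ i) (a *h c) * ev q (b *h (u *h S v)))).
  rewrite swC; apply: sw_ext => y v.
  rewrite (sw_mul HH) //; last by lin.
  by do 2!apply: sw_ext => ? ?; rewrite (hmulA HH).
(* Cyclicity of the trace: the coproduct is moved from the input [e_i] to the output, and the trace
   is now taken over the tensor square. *)
transitivity (\sum_a \sum_b sw (x *h e_ a) (fun s t => hcomul H s a b * ev q (t *h S (e_ b)))).
  under eq_bigr => i _ do rewrite {1}/sw hcomul_ebas.
  rewrite exchange_big /=; apply: eq_bigr => a _.
  rewrite exchange_big /=; apply: eq_bigr => b _.
  under eq_bigr => i _ do rewrite -swZl.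
  rewrite -sw_sum; apply: sw_ext => s t; rewrite /hcomul summxE mulr_suml.
  by apply: eq_bigr => i _; rewrite hpairC hpairE !mxE; ring.
rewrite /trl mulr_sumr; apply: eq_bigr => a _.
transitivity (sw (x *h e_ a) (fun c w => sw w (fun c' t => ev (e_ a) c * ev q (t *h S c')))).
  rewrite -(sw_coassoc HH _ (fun c c' t => ev (e_ a) c * ev q (t *h S c'))) -sw_sum.
  apply: sw_ext => s t.
  under eq_bigr => b _ do rewrite sw_hpair -swZr.
  rewrite -sw_sum; apply: sw_ext => c c'.
  rewrite (lform_basis c' (f := fun c' => ev q (t *h S c'))); last by lin.
  by rewrite mulr_sumr; apply: eq_bigr => b _; rewrite [ev (e_ b) _]hpairC hpairE; ring.
rewrite -hpairE [ev _ (e_ a)]hpairC mulrC -(sw_counitr HH (x *h e_ a) (f := fun z => ev (e_ a) z)); last by lin.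
rewrite -swZr; apply: sw_ext => c w.
(* The trace property of [q] reorders [t S(c')] into [S(c') t], to which the antipode axiom
   applies. *)
rewrite -mulrA -(sw_antipodel HH w (hpair_lform q)) swZl; congr (_ * _).
by apply: sw_ext => c' t; rewrite qC.
Qed.

End Regular.

(** * The square of the antipode *)

Section Involution.
Variables (k : fieldType) (d : nat) (H : hopf k d).
Local Notation V := 'rV[k]_d.
Local Notation "x *h y" := (hmul H x y) (at level 40, left associativity).
Local Notation "p *c q" := (conv H p q) (at level 40, left associativity).
Local Notation ev := hpair.
Local Notation eps := (hcounit H).
Local Notation e_ := (@ebas k d).
Local Notation S := (hant H).
Local Notation sw := (sw H).

Hypothesis Hk : [pchar k] =i pred0.
Hypothesis HH : is_hopf H.
Hypothesis Hss : semisimple H.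
Variables Lam lam : V.
Hypotheses (HLam : is_integral H Lam) (Hlam : is_dual_integral H lam).
Hypothesis HF0 : (d%:R^-1 *: lam) *c (d%:R^-1 *: lam) = d%:R^-1 *: lam.
Hypothesis lamLam : ev lam Lam = 1.

Lemma d_neq0 : d%:R != 0 :> k.
Proof.
rewrite (natr_eq0 Hk); apply/negP => /eqP d0.
have := hcounit1 HH; rewrite /hcounit big1 => [/esym/eqP|i _]; first by rewrite oner_eq0.
by have := ltn_ord i; rewrite [X in (_ < X)%N]d0.
Qed.

(** Idempotency of [lam / d] fixes the normalisation: [lam lam = lam(1) lam] with [lam] nonzero. *)
Lemma ev_lam1 : ev lam (h1 H) = d%:R.
Proof.
move: HF0; rewrite (lmapZ _ _ (conv_linl H _)) (lmapZ _ _ (conv_linr H _)).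
rewrite (proj1 (Hlam lam)) !scalerA => /(congr1 (fun p => ev p Lam)).
rewrite !(lformZ _ _ (hpair_lform_l Lam)) lamLam !mulr1 => E.
apply: (mulfI (x := d%:R^-1 * d%:R^-1)).
  by rewrite mulf_neq0 ?invr_eq0 ?d_neq0.
by rewrite E mulfVK ?d_neq0.
Qed.

(** Semisimplicity gives a left ideal [W] complementary to the kernel [U] of the counit. Writing
    [1 = u + w], one gets [Lam = Lam w] in [W]; if [eps Lam = 0], then [Lam] also lies in [U], hence
    is zero. *)
Lemma hcounit_Lam_neq0 : eps Lam != 0.
Proof.
(* The row space of [U] is the augmentation ideal, as the image of the projection
   [v |-> v - eps(v) 1]. *)
pose U : 'M[k]_d := \matrix_(a, b) (e_ a - eps (e_ a) *: h1 H) 0 b.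
have UE v : v *m U = v - eps v *: h1 H.
  apply: eq_hpairr => p; move: v; apply: eq_lform.
  - by move=> a u v; rewrite mulmxDl -scalemxAl hpair_lform.
  - move=> a u v; rewrite !(lformB _ _ (hpair_lform _)) !(lformZ _ _ (hpair_lform _)).
    by rewrite hpair_lform hcounit_lform; ring.
  by move=> a; congr (ev p _); apply/rowP => i; rewrite /ebas -rowE !mxE.
have UP v : eps v = 0 -> (v <= U)%MS.
  by move=> v0; apply/submxP; exists v; rewrite UE v0 scale0r subr0.
have epsU v : (v <= U)%MS -> eps v = 0.
  case/submxP => w ->; rewrite UE (lformB _ _ (@hcounit_lform _ _ H)).
  by rewrite (lformZ _ _ (@hcounit_lform _ _ H)) (hcounit1 HH) mulr1 subrr.
have Ust : stable (lreg H) U.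
  move=> a; apply/row_subP => i; rewrite row_mul; apply: UP.
  rewrite -(act_ebas (lreg H) a) act_lreg (hcounitM HH) (epsU (row i U)) ?mulr0 //.
  exact: row_sub.
have [W [Wst [UW0 UW1]]] := Hss (lreg_mod HH) Ust.
apply/negP => /eqP Lam0.
have /sub_addsmxP [[u v] /= uv] : (h1 H <= U + W)%MS by exact: submx_full.
have LamW : (Lam <= W)%MS.
  have -> : Lam = Lam *h (v *m W).
    rewrite (proj2 (HLam _)).
    have -> : v *m W = h1 H - u *m U by rewrite uv addrC addKr.
    rewrite (lformB _ _ (@hcounit_lform _ _ H)) (hcounit1 HH) epsU ?subr0 ?scale1r //.
    exact: submxMl.
  rewrite -act_lreg -mulmxA; apply: submx_trans (submxMl _ _) _.
  rewrite /act raddf_sum mulmx_sumr; apply: summx_sub => a _ /=.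
  by rewrite linearZ -scalemxAr; apply/scalemx_sub/Wst.
have : (Lam <= U :&: W)%MS by rewrite sub_capmx LamW UP.
move/eqP: UW0; rewrite mxrank_eq0 => /eqP ->; rewrite submx0 => /eqP L0.
move/eqP: lamLam; rewrite L0 (lform0 (hpair_lform lam)) eq_sym; exact/negP/oner_neq0.
Qed.

Local Notation chreg := (hchar (lreg H)).
Let SSlin : lmap (fun y => S (S y)).
Proof. by apply: lmap_hant; exact: hant_lin. Qed.
Let SS4 x : S (S (S (S x))) = x.
Proof. exact: (hant4 HH HLam Hlam lamLam). Qed.
Let SSM x y : S (S (x *h y)) = S (S x) *h S (S y).
Proof. by rewrite !(hantM HH HLam Hlam lamLam). Qed.

(** [S^2] is an algebra automorphism, so it conjugates left multiplication by [y] into left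
    multiplication by [S^2(y)]. *)
Lemma chreg_SS y : ev chreg (S (S y)) = ev chreg y.
Proof.
rewrite !hcharE !mxtrace_lreg -!mxtrace_mxl.
have -> : mxl (fun z => S (S y) *h z) =
    mxl (fun z => S (S z)) *m mxl (fun z => y *h z) *m mxl (fun z => S (S z)).
  apply: mxl_inj => x; rewrite !mulmxA !mxlE //; try exact: hmul_lin_r.
  by rewrite SSM SS4.
rewrite mxtrace_mulC mulmxA; congr (\tr _); apply: mxl_inj => x.
by rewrite mulmxA !mulmxA !mxlE ?SS4 //; exact: hmul_lin_r.
Qed.

Lemma chreg_Lam : ev chreg Lam = eps Lam.
Proof.
rewrite hcharE mxtrace_lreg /trl (lform_basis Lam (@hcounit_lform _ _ H)).
by apply: eq_bigr => a _; rewrite (proj2 (HLam _)) mxE mulrC.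
Qed.

(** For the idempotent [p = chreg / d], the projection [y |-> leftharp H y p] commutes with [S^2],
    an involution as [S^4 = 1]. Their product [M] satisfies [M^3 = M] and has trace [eps Lam], a
    difference of two ranks. *)
Lemma hcounit_Lam_nat : exists a b : nat, eps Lam = a%:R - b%:R.
Proof.
pose p := d%:R^-1 *: chreg.
have pp : p *c p = p.
  rewrite /p (lmapZ _ _ (conv_linl H _)) (lmapZ _ _ (conv_linr H _)).
  rewrite (hchar_lreg_conv HH) => [|x y]; last exact: hchar_traceC (lreg_mod HH).
  by rewrite (hchar1 (lreg_mod HH)) !scalerA mulfVK ?d_neq0.
pose M := mxl (fun y => S (S (leftharp H y p))).
pose P := mxl (fun y => leftharp H y p); pose Q := mxl (fun y => S (S y)).
have lhlin := leftharp_lin H p.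
have MPQ : M = P *m Q by rewrite mxl_comp.
have PQ : P *m Q = Q *m P.
  rewrite !mxl_comp //; apply: mxl_inj => y; rewrite !mxlE //; first last.
  - by move=> a u v; rewrite lhlin SSlin.
  - by move=> a u v; rewrite SSlin lhlin.
  apply: eq_hpairr => q; rewrite (sw_leftharp H y p (f := fun z => ev q (S (S z)))); last by lin.
  rewrite sw_leftharp; last exact: hpair_lform.
  rewrite !(sw_hant HH HLam Hlam lamLam); [|by lin|by lin].
  apply: sw_ext => a b; congr (_ * _).
  by rewrite !(lformZ _ _ (hpair_lform_l _)) chreg_SS.
have QQ : Q *m Q = 1%:M.
  by apply: mxl_inj => y; rewrite mulmxA !mxlE // mulmx1 SS4.
have PP : P *m P = P.
  apply: mxl_inj => y; rewrite mulmxA !mxlE //; apply: eq_hpairr => q.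
  by rewrite !ev_leftharp (convA HH) pp.
have M3 : M *m M *m M = M.
  have -> : M *m M = P by rewrite {1}MPQ MPQ PQ mulmxA -PQ -(mulmxA P) QQ mulmx1 PP.
  by rewrite MPQ mulmxA PP.
have [trM _] := mxtrace_tripotent Hk M3.
move: trM; rewrite mxtrace_mxl (trl_leftharpSS HH HLam Hlam lamLam) ev_lam1.
rewrite (lformZ _ _ (hpair_lform_l _)) chreg_Lam mulVKf ?d_neq0 // => ->.
by eexists; eexists.
Qed.

Lemma hant_invol_Lam : (forall x, S (S x) = x) /\ eps Lam = 1.
Proof.
have [a [b cab]] := hcounit_Lam_nat.
pose Q := mxl (fun y => S (S y)).
have QQ : Q *m Q = 1%:M.
  by apply: mxl_inj => y; rewrite mulmxA !mxlE // mulmx1 SS4.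
have trQ : \tr Q = d%:R * eps Lam.
  rewrite -ev_lam1 hcounitE -(trl_leftharpSS HH HLam Hlam lamLam) mxtrace_mxl.
  apply: eq_bigr => i _; congr ((S (S _)) 0 i); apply: eq_hpairr => p.
  by rewrite ev_leftharp (conv1l HH).
have Q3 : Q *m Q *m Q = Q by rewrite QQ mul1mx.
have [] := mxtrace_tripotent Hk Q3.
set P1 := 2%:R^-1 *: _; set P2 := 2%:R^-1 *: (_ - _).
rewrite QQ mxtrace1 trQ cab => E1 E2.
have F1 : d = (\rank P1 + \rank P2)%N by apply: (natr_inj Hk); rewrite natrD.
have F2 : (\rank P1 + d * b = \rank P2 + d * a)%N.
  apply: (natr_inj Hk); rewrite !natrD !natrM.
  have -> : (\rank P1)%:R = d%:R * (a%:R - b%:R) + (\rank P2)%:R :> k by rewrite E1 subrK.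
  by ring.
have ab : a <> b by move=> ab; move: hcounit_Lam_neq0; rewrite cab ab subrr eqxx.
have d0 : (0 < d)%N by move: d_neq0; rewrite (natr_eq0 Hk) lt0n.
have half0 (X : 'M[k]_d) : 2%:R^-1 *: X = 0 -> X = 0.
  move/eqP; rewrite scaler_eq0 invr_eq0 (negPf (two_neq0 Hk)) /=; exact/eqP.
(* The two eigenspaces of [S^2] have dimensions with sum [d] and difference the nonzero multiple
   [d (a - b)] of [d], so one of them vanishes. The case [S^2 = -1] is excluded by [S^2(1) = 1]. *)
have [ltab|ltba] : (a < b)%N \/ (b < a)%N by lia.
- have /eqP : \rank P1 = 0%N by nia.
  rewrite mxrank_eq0 => /eqP/half0; rewrite QQ => QN.
  have := mxlE (h1 H) SSlin; rewrite -/Q !(hant1 HH HLam Hlam lamLam) => h1Q.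
  have : (h1 H) *m (1%:M + Q) = 0 by rewrite QN mulmx0.
  rewrite mulmxDr h1Q mulmx1 => /(congr1 eps).
  rewrite (lformD _ _ (@hcounit_lform _ _ H)) (lform0 (@hcounit_lform _ _ H)).
  by rewrite (hcounit1 HH) => /eqP; rewrite (negPf (two_neq0 Hk)).
- have P20 : \rank P2 = 0%N by nia.
  have Q1 : Q = 1%:M.
    move/eqP: P20; rewrite mxrank_eq0 => /eqP/half0; rewrite QQ => /eqP.
    by rewrite subr_eq0 => /eqP.
  split=> [x|]; first by rewrite -(mxlE x SSlin) -/Q Q1 mulmx1.
  apply: (mulfI d_neq0); by rewrite mulr1 -cab -trQ Q1 mxtrace1.
Qed.

Lemma hantK x : S (S x) = x. Proof. by case: hant_invol_Lam. Qed.
Lemma hcounit_Lam : eps Lam = 1. Proof. by case: hant_invol_Lam. Qed.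

Lemma ev_lamC x y : ev lam (x *h y) = ev lam (y *h x).
Proof. by rewrite (ev_lam_swap HH HLam Hlam lamLam) hantK. Qed.

Lemma sw_antipodel' x f : lform f -> sw x (fun a b => f (S b *h a)) = eps x * f (h1 H).
Proof.
move=> fP; have := sw_antipodel HH x (f := fun z => f (S z)).
rewrite (hant1 HH HLam Hlam lamLam) => <-; last by lin.
by apply: sw_ext => a b; rewrite (hantM HH HLam Hlam lamLam) hantK.
Qed.

Lemma sw_antipoder' x f : lform f -> sw x (fun a b => f (b *h S a)) = eps x * f (h1 H).
Proof.
move=> fP; have := sw_antipoder HH x (f := fun z => f (S z)).
rewrite (hant1 HH HLam Hlam lamLam) => <-; last by lin.
by apply: sw_ext => a b; rewrite (hantM HH HLam Hlam lamLam) hantK.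
Qed.

(** In dual bases the trace of left multiplication by [x] is [<lam, Lam_2 S(Lam_1) S(x)>], and
    [Lam_2 S(Lam_1) = 1] because [S^2 = 1] and [eps Lam = 1]. *)
Lemma lam_chreg : lam = chreg.
Proof.
apply: eq_hpair => x; rewrite hcharE mxtrace_lreg.
rewrite (trlE HH HLam Hlam lamLam); last exact: hmul_lin_r.
transitivity (sw Lam (fun a b => ev lam (b *h S a *h S x))).
  rewrite (sw_antipoder' Lam (f := fun z => ev lam (z *h S x))); last by lin.
  by rewrite hcounit_Lam mul1r (hmul1l HH) (ev_lamS HH HLam Hlam lamLam).
by apply: sw_ext => a b; rewrite (hantM HH HLam Hlam lamLam) (hmulA HH).
Qed.

Lemma trl_leftharp p : trl (fun y => leftharp H y p) = d%:R * ev p Lam.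
Proof.
rewrite -ev_lam1 -(trl_leftharpSS HH HLam Hlam lamLam).
by apply: eq_bigr => a _; rewrite hantK.
Qed.

End Involution.

(** * Modules and their coefficients *)

Section Modules.
Variables (k : fieldType) (d : nat) (H : hopf k d).
Local Notation V := 'rV[k]_d.
Local Notation "x *h y" := (hmul H x y) (at level 40, left associativity).
Local Notation "p *c q" := (conv H p q) (at level 40, left associativity).
Local Notation ev := hpair.
Local Notation e_ := (@ebas k d).
Local Notation sw := (sw H).

Definition commutant n (rho : 'I_d -> 'M[k]_n) (B : 'M[k]_n) :=
  forall a, rho a *m B = B *m rho a.

Lemma commutant_act n (rho : 'I_d -> 'M[k]_n) B x :
  commutant rho B -> act rho x *m B = B *m act rho x.
Proof.
move=> cB; rewrite /act mulmx_suml mulmx_sumr; apply: eq_bigr => a _.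
by rewrite -scalemxAl -scalemxAr cB.
Qed.

(** As [T] varies this runs over all matrix coefficients of [rho]; traces against [T] avoid a choice
    of indices. *)
Definition mcoef n (rho : 'I_d -> 'M[k]_n) (T : 'M[k]_n) : V := \row_a \tr (T *m rho a).

Lemma mcoefE n (rho : 'I_d -> 'M[k]_n) T x : ev (mcoef rho T) x = \tr (T *m act rho x).
Proof.
rewrite /act mulmx_sumr raddf_sum; apply: eq_bigr => a _ /=.
by rewrite mxE -scalemxAr mxtraceZ mulrC.
Qed.

Lemma mcoef1 n (rho : 'I_d -> 'M[k]_n) : mcoef rho 1%:M = hchar rho.
Proof. by apply/rowP => a; rewrite !mxE mul1mx. Qed.

(** The action on the image of the idempotent [e], in the coordinates of its rank factorization. *)
Definition subrep n (rho : 'I_d -> 'M[k]_n) (e : 'M[k]_n) a : 'M[k]_(\rank e) :=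
  row_base e *m rho a *m col_base e.

Lemma act_subrep n (rho : 'I_d -> 'M[k]_n) e x :
  act (subrep rho e) x = row_base e *m act rho x *m col_base e.
Proof.
rewrite /act mulmx_sumr mulmx_suml; apply: eq_bigr => a _.
by rewrite -scalemxAr -scalemxAl.
Qed.

Lemma idem_col_base n (e : 'M[k]_n) : e *m e = e -> e *m col_base e = col_base e.
Proof. by move=> /base_idem ee; rewrite -[X in X *m _](mulmx_base e) -mulmxA ee mulmx1. Qed.

Lemma idem_row_base n (e : 'M[k]_n) : e *m e = e -> row_base e *m e = row_base e.
Proof. by move=> /base_idem ee; rewrite -[X in _ *m X](mulmx_base e) mulmxA ee mul1mx. Qed.

Lemma subrep_mul n (e X Y : 'M[k]_n) : e *m e = e -> e *m Y = Y *m e ->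
  row_base e *m X *m col_base e *m (row_base e *m Y *m col_base e)
  = row_base e *m (X *m Y) *m col_base e.
Proof.
move=> ee eY.
transitivity (row_base e *m (X *m (col_base e *m row_base e) *m Y) *m col_base e).
  by rewrite !mulmxA.
rewrite mulmx_base -(mulmxA X e Y) eY -!(mulmxA (row_base e)) -!mulmxA.
by rewrite idem_col_base.
Qed.

Lemma subrep_mull n (e X Y : 'M[k]_n) : e *m e = e -> e *m X = X *m e ->
  row_base e *m X *m col_base e *m (row_base e *m Y *m col_base e)
  = row_base e *m (X *m Y) *m col_base e.
Proof.
move=> ee eX.
transitivity (row_base e *m (X *m (col_base e *m row_base e) *m Y) *m col_base e).
  by rewrite !mulmxA.
by rewrite mulmx_base -eX -(mulmxA e X Y) (mulmxA (row_base e)) idem_row_base.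
Qed.

Lemma subrep_mod n (rho : 'I_d -> 'M[k]_n) e : is_hmod H rho ->
  e *m e = e -> commutant rho e -> is_hmod H (subrep rho e).
Proof.
move=> [rM r1] ee ce; split=> [x y|].
  by rewrite !act_subrep rM subrep_mul // commutant_act.
by rewrite act_subrep r1 mulmx1 base_idem.
Qed.

Lemma idemC n (e : 'M[k]_n) : e *m e = e -> (1%:M - e) *m (1%:M - e) = 1%:M - e.
Proof. by move=> ee; rewrite mulmxBl mul1mx mulmxBr mulmx1 ee subrr subr0. Qed.

Lemma commutantC n (rho : 'I_d -> 'M[k]_n) e : commutant rho e -> commutant rho (1%:M - e).
Proof. by move=> ce a; rewrite mulmxBl mulmxBr mulmx1 mul1mx ce. Qed.

Lemma mcoef_subrep n (rho : 'I_d -> 'M[k]_n) e T : e *m e = e -> commutant rho e ->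
  mcoef (subrep rho e) (row_base e *m T *m col_base e) = mcoef rho (T *m e).
Proof.
move=> ee ce; apply/rowP => a; rewrite !mxE.
rewrite subrep_mul //.
rewrite mxtrace_mulC.
rewrite (mulmxA (col_base e)) mulmx_base mxtrace_mulC.
by rewrite -(mulmxA T (rho a)) ce mulmxA.
Qed.

Lemma mcoefD n (rho : 'I_d -> 'M[k]_n) T T' : mcoef rho (T + T') = mcoef rho T + mcoef rho T'.
Proof. by apply/rowP => a; rewrite !mxE mulmxDl mxtraceD. Qed.

Lemma mcoefZ n (rho : 'I_d -> 'M[k]_n) a T : mcoef rho (a *: T) = a *: mcoef rho T.
Proof. by apply/rowP => b; rewrite !mxE -scalemxAl mxtraceZ. Qed.

Lemma mcoef_split n (rho : 'I_d -> 'M[k]_n) e T : e *m e = e -> commutant rho e ->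
  mcoef rho T = mcoef (subrep rho e) (row_base e *m T *m col_base e)
   + mcoef (subrep rho (1%:M - e)) (row_base (1%:M - e) *m T *m col_base (1%:M - e)).
Proof.
move=> ee ce; rewrite !mcoef_subrep //; [|exact: idemC|exact: commutantC].
by rewrite -mcoefD -mulmxDr addrC subrK mulmx1.
Qed.

Lemma hchar_split n (rho : 'I_d -> 'M[k]_n) e : e *m e = e -> commutant rho e ->
  hchar rho = hchar (subrep rho e) + hchar (subrep rho (1%:M - e)).
Proof.
move=> ee ce; rewrite -mcoef1 (mcoef_split _ ee ce) !mulmx1.
by rewrite !base_idem ?mcoef1 //; exact: idemC.
Qed.

Lemma hchar_subrep n (rho : 'I_d -> 'M[k]_n) e : e *m e = e -> commutant rho e ->
  hchar (subrep rho e) = mcoef rho e.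
Proof.
move=> ee ce; rewrite -mcoef1 -[e in RHS]mul1mx -mcoef_subrep //.
by rewrite mulmx1 base_idem.
Qed.

Hypothesis HH : is_hopf H.
Hypothesis Hss : semisimple H.

(** [e] is the transpose of the projection onto [U] along a stable complement; stability of both
    summands makes it commute with the action. *)
Lemma stable_idem n (rho : 'I_d -> 'M[k]_n) (U : 'M[k]_n) :
  is_hmod H rho -> stable rho U ->
  exists e, [/\ e *m e = e, commutant rho e, (e^T <= U)%MS & U *m e^T = U].
Proof.
move=> rM Ust; have [W [Wst [UW0 UW1]]] := Hss rM Ust.
have {}UW0 : (U :&: W = 0)%MS by apply/eqP; rewrite -mxrank_eq0 UW0.
have [P [PU UP WP]] : exists P : 'M[k]_n, [/\ (P <= U)%MS, U *m P = U & W *m P = 0].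
  exists (proj_mx U W); split; last by apply: proj_mx_0.
    by rewrite -[proj_mx U W]mul1mx proj_mx_sub.
  by apply: proj_mx_id.
exists P^T; rewrite trmxK.
split=> //.
  rewrite -trmx_mul; congr (_^T).
  by case/submxP: (PU) => D PD; rewrite {1}PD -mulmxA UP.
move=> a; apply: trmx_inj; rewrite !trmx_mul trmxK.
apply/mxl_inj => v.
have /sub_addsmxP [[u w] /= ->] : (v <= U + W)%MS by exact: submx_full.
rewrite !mulmxDl !mulmxA -(mulmxA u U P) UP -(mulmxA w W P) WP mulmx0 mul0mx addr0.
have /submxP [A EA] := Ust a; have /submxP [B EB] := Wst a.
rewrite -(mulmxA u U) -(mulmxA w W) EA EB !mulmxA -(mulmxA _ U P) UP.
by rewrite -(mulmxA _ W P) WP mulmx0 addr0.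
Qed.

(** Complete reducibility as an induction principle on the dimension: a reducible module splits
    along a nontrivial idempotent of its commutant. *)
Lemma hmod_ind (P : forall n, ('I_d -> 'M[k]_n) -> Prop) :
  (forall n (rho : 'I_d -> 'M[k]_n), is_hmod H rho -> irr_mod rho -> P n rho) ->
  (forall rho : 'I_d -> 'M[k]_0, P 0%N rho) ->
  (forall n (rho : 'I_d -> 'M[k]_n) e, is_hmod H rho -> e *m e = e -> commutant rho e ->
     P _ (subrep rho e) -> P _ (subrep rho (1%:M - e)) -> P n rho) ->
  forall n (rho : 'I_d -> 'M[k]_n), is_hmod H rho -> P n rho.
Proof.
move=> Pirr P0 Psplit n; have [m] := ubnP n.
elim: m n => // m IH n /ltnSE le_nm rho rM.
case: (posnP n) => [n0|n_gt0]; first by move: rho rM; rewrite n0 => rho _; exact: P0.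
have [irr|] := classic (irr_mod rho); first exact: Pirr.
move=> nirr; have [U [Ust U0 U1]] : exists U, [/\ stable rho U, \rank U <> 0%N & ~ row_full U].
  apply: NNPP => noU; apply: nirr; split=> // U Ust.
  by apply: NNPP => nU; apply: noU; exists U; split=> // ?; apply: nU; [left|right].
have [e [ee ce eU Ue]] := stable_idem rM Ust.
have re : \rank e = \rank U.
  apply/eqP; rewrite -(mxrank_tr e) eqn_leq mxrankS //=.
  by rewrite -{1}Ue mxrankM_maxr.
have rlt : (\rank U < n)%N.
  by rewrite ltn_neqAle rank_leq_col andbT; apply/negP.
have rC : (\rank e + \rank (1%:M - e)%R <= n)%N.
  by apply: mulmx0_rank_max; rewrite mulmxBr mulmx1 ee subrr.
apply: (Psplit _ _ e) => //; apply: IH; try exact: subrep_mod.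
- by rewrite re; lia.
- by lia.
- by apply: subrep_mod => //; [exact: idemC|exact: commutantC].
Qed.

End Modules.

(** * Schur's lemma and decomposition into irreducibles *)

Section Decomposition.
Variables (k : closedFieldType) (d : nat) (H : hopf k d).
Local Notation V := 'rV[k]_d.
Local Notation "x *h y" := (hmul H x y) (at level 40, left associativity).
Local Notation "p *c q" := (conv H p q) (at level 40, left associativity).
Local Notation ev := hpair.
Local Notation e_ := (@ebas k d).
Local Notation sw := (sw H).

(** An eigenvalue exists over a closed field, and its eigenspace is a nonzero submodule. *)
Lemma schur n (rho : 'I_d -> 'M[k]_n) B : irr_mod rho -> commutant rho B ->
  exists a, B = a%:M.
Proof.
case=> n_gt0 irr cB; have [a] : exists a, root (char_poly B^T) a.
  by apply/closed_rootP; rewrite size_char_poly; case: (n) n_gt0.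
rewrite -eigenvalue_root_char => aB.
have Est : stable rho (eigenspace B^T a).
  move=> i; apply/eigenspaceP; rewrite -mulmxA -trmx_mul -cB trmx_mul mulmxA.
  by rewrite (eigenspaceP (submx_refl _)) -scalemxAl.
case: (irr _ Est) => [/eqP|/row_fullP [X XE]].
  by rewrite mxrank_eq0 (negPf aB).
exists a; apply: trmx_inj; rewrite -[LHS]mul1mx -XE -mulmxA.
rewrite (eigenspaceP (submx_refl _)) -scalemxAr XE.
by rewrite tr_scalar_mx scalemx1.
Qed.

Lemma inRH0 : inRH H 0.
Proof. by exists [::]; split=> //; rewrite big_nil. Qed.

Lemma inRHD p q : inRH H p -> inRH H q -> inRH H (p + q).
Proof.
move=> [s [sP ->]] [t [tP ->]]; exists (s ++ t); rewrite big_cat; split=> // x.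
by rewrite mem_cat => /orP [/sP|/tP].
Qed.

Lemma inRHZ a p : inRH H p -> inRH H (a *: p).
Proof.
move=> [s [sP ->]]; exists [seq (a * x.1, x.2) | x <- s]; split.
  by move=> x /mapP [y /sP yP ->].
by rewrite big_map scaler_sumr; apply: eq_bigr => x _; rewrite scalerA.
Qed.

Lemma inRH_irr p : is_irr_char H p -> inRH H p.
Proof.
move=> pP; exists [:: (1, p)]; split; last by rewrite big_seq1 scale1r.
by move=> x; rewrite inE => /eqP ->.
Qed.

Lemma inRH_sum (P : V -> Prop) : P 0 -> (forall a p q, P p -> P q -> P (a *: p + q)) ->
  (forall p, is_irr_char H p -> P p) -> forall p, inRH H p -> P p.
Proof.
move=> P0 PD Pirr p [s [sP ->]]; elim: s sP => [|x s IH] sP; first by rewrite big_nil.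
rewrite big_cons; apply: PD; first by apply/Pirr/sP; rewrite inE eqxx.
by apply: IH => y ys; apply: sP; rewrite inE ys orbT.
Qed.

Hypothesis HH : is_hopf H.
Hypothesis Hss : semisimple H.

(** By Schur's lemma [T] is a scalar on an irreducible module, which gives a multiple of the
    character; in general [T] is compressed to both summands of a splitting. *)
Lemma mcoef_inRH n (rho : 'I_d -> 'M[k]_n) T : is_hmod H rho -> commutant rho T ->
  inRH H (mcoef rho T).
Proof.
move=> rM; move: T; move: n rho rM.
apply: (hmod_ind (H := H)) => // [n rho rM irr T /(schur irr) [a ->]|rho T _|n rho e rM ee ce IH1 IH2 T cT].
- rewrite -scalemx1 mcoefZ mcoef1; apply/inRHZ/inRH_irr.
  by exists n, rho.
- suff -> : mcoef rho T = 0 by exact: inRH0.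
  by apply/rowP => a; rewrite !mxE /mxtrace big_ord0.
have sub_comm f : f *m f = f -> commutant rho f ->
    commutant (subrep rho f) (row_base f *m T *m col_base f).
  move=> ff cf a; rewrite /subrep subrep_mull // ?cf // cT.
  by rewrite -subrep_mul // cf.
by rewrite (mcoef_split T ee ce); apply: inRHD; [apply: IH1|apply: IH2]; apply: sub_comm => //;
  [exact: idemC|exact: commutantC].
Qed.

Lemma hchar_inRH n (rho : 'I_d -> 'M[k]_n) : is_hmod H rho -> inRH H (hchar rho).
Proof.
by move=> rM; rewrite -mcoef1; apply: mcoef_inRH => // a; rewrite mulmx1 mul1mx.
Qed.

(** The last clause says that the coefficients of [rho] are sums of coefficients of irreducibles
    with character in [L], phrased as an induction principle to avoid carrying the summands
    along. *)
Lemma hmod_decomp n (rho : 'I_d -> 'M[k]_n) : is_hmod H rho ->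
  exists L : seq V, [/\ forall x, x \in L -> is_irr_char H x,
    hchar rho = \sum_(x <- L) x &
    forall T (P : V -> Prop), P 0 -> (forall p q, P p -> P q -> P (p + q)) ->
    (forall n' (rho' : 'I_d -> 'M[k]_n') T', is_hmod H rho' -> irr_mod rho' ->
       hchar rho' \in L -> P (mcoef rho' T')) -> P (mcoef rho T)].
Proof.
move: n rho; apply: (hmod_ind (H := H)) => // [n rho rM irr|rho|n rho e rM ee ce].
- exists [:: hchar rho]; split; last 1 first.
  + by move=> T P _ _; apply=> //; rewrite inE.
  + by move=> x; rewrite inE => /eqP ->; exists n, rho.
  + by rewrite big_seq1.
- have c0 T : mcoef rho T = 0 by apply/rowP => a; rewrite !mxE /mxtrace big_ord0.
  exists [::]; split=> //; first by rewrite -mcoef1 c0 big_nil.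
  by move=> T P P0 _ _; rewrite c0.
case=> L1 [L1P h1 c1] [L2 [L2P h2 c2]]; exists (L1 ++ L2); split.
- by move=> x; rewrite mem_cat => /orP [/L1P|/L2P].
- by rewrite big_cat /= -h1 -h2; exact: hchar_split.
move=> T P P0 PD PL; rewrite (mcoef_split T ee ce); apply: (PD).
  by apply: (c1 _ P P0 PD) => n' rho' T' ? ? ?; apply: PL => //; rewrite mem_cat; apply/orP; left.
by apply: (c2 _ P P0 PD) => n' rho' T' ? ? ?; apply: PL => //; rewrite mem_cat; apply/orP; right.
Qed.

Definition intertwiner n m (rho : 'I_d -> 'M[k]_n) (mu : 'I_d -> 'M[k]_m) (f : 'M[k]_(n, m)) :=
  forall a, rho a *m f = f *m mu a.

(** A nonzero [f] is injective because [mu] is irreducible. The idempotent onto its image factors as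
    [f g^T] with [g^T f = 1], so it carries the character of [mu], and the complementary idempotent
    carries [u]. *)
Lemma intertwiner_summand n m (rho : 'I_d -> 'M[k]_n) (mu : 'I_d -> 'M[k]_m) f :
  is_hmod H rho -> is_hmod H mu -> irr_mod mu -> intertwiner rho mu f -> f <> 0 ->
  exists n' (u : 'I_d -> 'M[k]_n'), [/\ is_hmod H u, hchar rho = hchar mu + hchar u
    & irr_mod rho -> hchar u = 0].
Proof.
move=> rM mM [m_gt0 irr] fI f0.
have kst : stable mu (kermx f^T).
  move=> a; apply/sub_kermxP; rewrite -mulmxA -trmx_mul -fI trmx_mul mulmxA.
  by rewrite mulmx_ker mul0mx.
have finj : row_free f^T.
  rewrite -kermx_eq0 -mxrank_eq0; case: (irr _ kst) => [->//|/row_fullP [X XK]].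
  case: f0; apply: trmx_inj; rewrite trmx0 -[LHS]mul1mx -XK -mulmxA.
  by rewrite mulmx_ker mulmx0.
have ist : stable rho <<f^T>>%MS.
  move=> a; rewrite (eqmxMr _ (genmxE _)) genmxE -trmx_mul fI trmx_mul.
  exact: submxMl.
have [e [ee ce]] := stable_idem Hss rM ist.
rewrite genmxE => /submxP [g eg] ge.
have fe : f^T *m e^T = f^T.
  have /submxP [D ->] : (f^T <= <<f^T>>)%MS by rewrite genmxE.
  by rewrite -mulmxA ge.
have efg : e = f *m g^T by apply: trmx_inj; rewrite eg trmx_mul trmxK.
have gf : g^T *m f = 1%:M.
  apply: trmx_inj; apply: (row_free_inj finj); rewrite trmx1 mul1mx trmx_mul trmxK.
  by rewrite -mulmxA -eg.
exists (\rank (1%:M - e)%R), (subrep rho (1%:M - e)); split.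
- by apply: subrep_mod => //; [exact: idemC|exact: commutantC].
- rewrite [LHS](hchar_split ee ce); congr (_ + _).
  rewrite hchar_subrep //; apply/rowP => a; rewrite !mxE efg.
  by rewrite -mulmxA mxtrace_mulC -mulmxA fI mulmxA gf mul1mx.
case=> _ /(_ _ ist) [/eqP|/row_fullP [X XE]].
  by rewrite mxrank_gen mxrank_eq0 -trmx0 => /eqP/trmx_inj.
have e1 : e = 1%:M.
  by apply: trmx_inj; rewrite trmx1 -[LHS]mul1mx -XE -mulmxA ge.
rewrite hchar_subrep; [|exact: idemC|exact: commutantC].
by apply/rowP => a; rewrite !mxE e1 subrr mul0mx mxtrace0.
Qed.

End Decomposition.

(** * Tensor products of modules and the trivial module *)

Section Tensor.
Variables (k : fieldType) (d : nat) (H : hopf k d).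
Local Notation V := 'rV[k]_d.
Local Notation "x *h y" := (hmul H x y) (at level 40, left associativity).
Local Notation "p *c q" := (conv H p q) (at level 40, left associativity).
Local Notation ev := hpair.
Local Notation e_ := (@ebas k d).
Local Notation sw := (sw H).

Lemma mxtrace_tens m n (A : 'M[k]_m) (B : 'M[k]_n) : \tr (A *t B) = \tr A * \tr B.
Proof.
rewrite /mxtrace mulr_sum; apply: eq_bigr => i _.
by case: (mxtens_indexP i) => a b; rewrite tensmxE mxtens_indexK.
Qed.

Definition tens n m (rho : 'I_d -> 'M[k]_n) (mu : 'I_d -> 'M[k]_m) (a : 'I_d) : 'M[k]_(n * m) :=
  \sum_b \sum_c hD H a b c *: (rho b *t mu c).

Lemma act_tensE n m (rho : 'I_d -> 'M[k]_n) (mu : 'I_d -> 'M[k]_m) x i j :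
  act (tens rho mu) x i j = sw x (fun a b => (act rho a *t act mu b) i j).
Proof.
rewrite [act (tens _ _) x]/act summxE /sw.
transitivity (\sum_a \sum_b \sum_c x 0 a * hD H a b c * (rho b *t mu c) i j).
  apply: eq_bigr => a _; rewrite mxE summxE mulr_sumr; apply: eq_bigr => b _.
  rewrite summxE mulr_sumr; apply: eq_bigr => c _; rewrite mxE; ring.
rewrite exchange_big /=; apply: eq_bigr => b _.
rewrite exchange_big /=; apply: eq_bigr => c _.
rewrite -mulr_suml !act_ebas; congr (_ * _).
by rewrite /hcomul summxE; apply: eq_bigr => a _; rewrite mxE.
Qed.

Lemma mcoef_tens n m (rho : 'I_d -> 'M[k]_n) (mu : 'I_d -> 'M[k]_m) T T' :
  mcoef (tens rho mu) (T *t T') = mcoef rho T *c mcoef mu T'.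
Proof.
apply: eq_hpair => x; rewrite conv_hpair mcoefE.
transitivity (sw x (fun a b => \tr ((T *t T') *m (act rho a *t act mu b)))).
  rewrite /mxtrace [RHS]sw_sum; apply: eq_bigr => i _; rewrite mxE.
  transitivity (sw x (fun a b => \sum_j (T *t T') i j * (act rho a *t act mu b) j i)).
    rewrite sw_sum; apply: eq_bigr => j _; rewrite swZl; congr (_ * _).
    exact: act_tensE.
  by apply: sw_ext => a b; rewrite mxE.
by apply: sw_ext => a b; rewrite tensmx_mul mxtrace_tens !mcoefE.
Qed.

Lemma tens1mx n m : (1%:M *t 1%:M : 'M[k]_(n * m)) = 1%:M.
Proof.
apply/matrixP => i j; case: (mxtens_indexP i) => a b; case: (mxtens_indexP j) => a' b'.
rewrite tensmxE !mxE (inj_eq (can_inj (@mxtens_indexK _ _))) xpair_eqE.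
by case: eqP; case: eqP; rewrite ?mulr0 ?mulr1.
Qed.

Lemma hchar_tens n m (rho : 'I_d -> 'M[k]_n) (mu : 'I_d -> 'M[k]_m) :
  hchar (tens rho mu) = hchar rho *c hchar mu.
Proof. by rewrite -!mcoef1 -mcoef_tens tens1mx. Qed.

Hypothesis HH : is_hopf H.

Lemma tens_mod n m (rho : 'I_d -> 'M[k]_n) (mu : 'I_d -> 'M[k]_m) :
  is_hmod H rho -> is_hmod H mu -> is_hmod H (tens rho mu).
Proof.
move=> [rM r1] [mM m1].
have tE i j : bform (fun a b => (act rho a *t act mu b) i j).
  by split=> ? a u v; rewrite act_lin !mxE; ring.
split=> [x y|].
  apply/matrixP => i j; rewrite act_tensE (sw_mul HH) // mxE.
  under [RHS]eq_bigr => l _ do rewrite !act_tensE -swZr.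
  rewrite -sw_sum; apply: sw_ext => a b.
  under [RHS]eq_bigr => l _ do rewrite -swZl.
  rewrite -sw_sum; apply: sw_ext => c e.
  by rewrite rM mM -tensmx_mul mxE.
apply/matrixP => i j; rewrite act_tensE -tens1mx -r1 -m1.
case: (HH) => _ _ _ _ [[_ D1] _ _].
case: (tE i j) => tl tr; rewrite (lform_basis _ (tl _)) /sw D1.
apply: eq_bigr => b _; rewrite (lform_basis _ (tr _)) mulr_sumr.
by apply: eq_bigr => c _; rewrite mxE big_ord1 mxE mulrA.
Qed.

Definition triv (a : 'I_d) : 'M[k]_1 := (he H a)%:M.

Lemma hchar_triv : hchar triv = heps H.
Proof. by apply/rowP => a; rewrite !mxE mxtrace_scalar. Qed.

Lemma act_triv x : act triv x = (hcounit H x)%:M.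
Proof.
rewrite /act /hcounit (big_morph (@scalar_mx k 1) (raddfD _) (raddf0 _)).
by apply: eq_bigr => a _; rewrite scale_scalar_mx.
Qed.

Lemma triv_mod : is_hmod H triv.
Proof.
split=> [x y|]; rewrite !act_triv ?(hcounit1 HH) //.
by rewrite (hcounitM HH) -scalar_mxM.
Qed.

Lemma triv_irr : irr_mod triv.
Proof.
split=> // U _; have := rank_leq_row U; rewrite /row_full; case: (\rank U) => [|[|//]]; by [left|right].
Qed.

End Tensor.

(** * The character ring *)

Section CharacterRing.
Variables (k : closedFieldType) (d : nat) (H : hopf k d).
Local Notation V := 'rV[k]_d.
Local Notation "x *h y" := (hmul H x y) (at level 40, left associativity).
Local Notation "p *c q" := (conv H p q) (at level 40, left associativity).
Local Notation ev := hpair.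
Local Notation eps := (hcounit H).
Local Notation e_ := (@ebas k d).
Local Notation S := (hant H).
Local Notation sw := (sw H).

Hypothesis Hk : [pchar k] =i pred0.
Hypothesis HH : is_hopf H.
Hypothesis Hss : semisimple H.
Variables Lam lam : V.
Hypotheses (HLam : is_integral H Lam) (Hlam : is_dual_integral H lam).
Hypothesis HF0 : (d%:R^-1 *: lam) *c (d%:R^-1 *: lam) = d%:R^-1 *: lam.
Hypothesis lamLam : ev lam Lam = 1.

Let SK x : S (S x) = x. Proof. exact: (hantK Hk HH Hss HLam Hlam HF0 lamLam). Qed.
Let SM x y : S (x *h y) = S y *h S x. Proof. exact: (hantM HH HLam Hlam lamLam). Qed.
Let lamC x y : ev lam (x *h y) = ev lam (y *h x).
Proof. exact: (ev_lamC Hk HH Hss HLam Hlam HF0 lamLam). Qed.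
Let epsLam : eps Lam = 1. Proof. exact: (hcounit_Lam Hk HH Hss HLam Hlam HF0 lamLam). Qed.

Lemma sw_Lam_move h F : bform F ->
  sw Lam (fun a b => F (h *h a) b) = sw Lam (fun a b => F a (S h *h b)).
Proof. by move=> FP; rewrite (sw_Lam_mulr HH HLam (S h) FP) SK. Qed.

(** The antipode of [H^*]; it sends the character of a module to that of the dual module. *)
Definition hdual (p : V) : V := frow (fun x => ev p (S x)).

Lemma hdualE p x : ev (hdual p) x = ev p (S x).
Proof. by rewrite frowE //; lin. Qed.

Lemma mulmx_sw m n m' n' (A : 'M[k]_(m', m)) (B : 'M[k]_(n, n')) x (G : V -> V -> 'M[k]_(m, n)) :
  A *m (\matrix_(i, j) sw x (fun a b => G a b i j)) *m B
  = \matrix_(i, j) sw x (fun a b => (A *m G a b *m B) i j).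
Proof.
apply/matrixP => i j; rewrite !mxE.
transitivity (\sum_l sw x (fun a b => (A *m G a b) i l * B l j)).
  apply: eq_bigr => l _; rewrite swZr mxE; congr (_ * _).
  transitivity (\sum_u sw x (fun a b => A i u * G a b u l)).
    by apply: eq_bigr => u _; rewrite mxE swZl.
  by rewrite -sw_sum; apply: sw_ext => a b; rewrite mxE.
by rewrite -sw_sum; apply: sw_ext => a b; rewrite mxE.
Qed.

(* Lam_1 X S(Lam_2) is an intertwiner for every matrix X. *)
Lemma hom_average n m (rho : 'I_d -> 'M[k]_n) (mu : 'I_d -> 'M[k]_m) :
  is_hmod H rho -> is_hmod H mu ->
  (forall f : 'M_(n, m), intertwiner rho mu f -> f = 0) ->
  forall T T', ev (mcoef rho T *c hdual (mcoef mu T')) Lam = 0.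
Proof.
move=> [rM r1] [mM m1] hom0 T T'.
pose G X a b : 'M[k]_(n, m) := act rho a *m X *m act mu (S b).
pose Y X := \matrix_(i, j) sw Lam (fun a b => G X a b i j).
have Y0 X : Y X = 0.
  apply: hom0 => h; rewrite -(act_ebas rho h) -(act_ebas mu h); move: (e_ h) => {}h.
  rewrite -[LHS]mulmx1 mulmx_sw -[RHS]mul1mx mulmxA mulmx_sw.
  apply/matrixP => i j; rewrite !mxE.
  have FP : bform (fun a b => G X a b i j).
    by split=> ? a u v; rewrite /G ?hant_lin act_lin ?mulmxDl ?mulmxDr -?scalemxAl -?scalemxAr !mxE.
  transitivity (sw Lam (fun a b => G X (h *h a) b i j)).
    by apply: sw_ext => a b; rewrite mulmx1 /G rM !mulmxA.
  rewrite (sw_Lam_move h FP); apply: sw_ext => a b.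
  by rewrite mul1mx /G SM SK mM !mulmxA.
rewrite conv_hpair.
(* Averaging the elementary matrices recovers a product of two traces, since [tr(A) tr(B)] is the
   sum over [i, j] of the [(i, j)] entries of [A E_ij B]. *)
transitivity (\sum_i \sum_j (T *m Y (delta_mx i j) *m T') i j).
  under [RHS]eq_bigr => i _ do under eq_bigr => j _ do rewrite mulmx_sw mxE.
  under [RHS]eq_bigr => i _ do rewrite -sw_sum.
  rewrite -sw_sum; apply: sw_ext => a b.
  rewrite hdualE !mcoefE [\tr (T' *m _)]mxtrace_mulC [in LHS]/mxtrace mulr_suml.
  apply: eq_bigr => i _; rewrite mulr_sumr; apply: eq_bigr => j _.
  transitivity ((T *m act rho a *m delta_mx i j *m (act mu (S b) *m T')) i j).
    rewrite -(mul_delta_mx (0 : 'I_1)) -!mulmxA -rowE !mulmxA -colE.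
    by rewrite [RHS]mxE big_ord1 [in RHS]mxE [in X in _ = _ * X]mxE.
  by rewrite /G !mulmxA.
by rewrite big1 // => i _; rewrite big1 // => j _; rewrite Y0 mulmx0 mul0mx mxE.
Qed.

(** A nonzero pairing forces, by [hom_average], a nonzero intertwiner; this is the test by which
    constituents are detected below. *)
Lemma hchar_summand n m (rho : 'I_d -> 'M[k]_n) (mu : 'I_d -> 'M[k]_m) :
  is_hmod H rho -> is_hmod H mu -> irr_mod mu ->
  ev (hchar rho *c hdual (hchar mu)) Lam != 0 ->
  exists n' (u : 'I_d -> 'M[k]_n'), [/\ is_hmod H u, hchar rho = hchar mu + hchar u
    & irr_mod rho -> hchar u = 0].
Proof.
move=> rM mM irr ne0; apply: NNPP => no.
case/eqP: ne0; rewrite -!mcoef1; apply: hom_average => // f fI.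
by apply: NNPP => f0; apply: no; apply: (intertwiner_summand Hss rM mM irr fI).
Qed.

Lemma hchar_irr_eq n m (rho : 'I_d -> 'M[k]_n) (mu : 'I_d -> 'M[k]_m) :
  is_hmod H rho -> irr_mod rho -> is_hmod H mu -> irr_mod mu ->
  ev (hchar rho *c hdual (hchar mu)) Lam != 0 -> hchar rho = hchar mu.
Proof.
move=> rM ri mM mi /(hchar_summand rM mM mi) [n' [u [_ -> /(_ ri) ->]]].
by rewrite addr0.
Qed.

Lemma irr_Lam_neq0 x : is_irr_char H x -> ev x Lam != 0 -> x = heps H.
Proof.
case=> n [rho [rM ri ->]] L0; rewrite -hchar_triv; apply: hchar_irr_eq => //.
- exact: triv_mod.
- exact: triv_irr.
suff -> : hdual (hchar (triv H)) = heps H by rewrite conv1r.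
apply: eq_hpair => y; rewrite hdualE hchar_triv -!hcounitE.
exact: (hcounitS HH HLam Hlam lamLam).
Qed.

Lemma Lam_nondegr q : (forall p, ev (p *c q) Lam = 0) -> q = 0.
Proof.
move=> q0; apply: eq_hpair => h; rewrite (lform0 (hpair_lform_l h)).
rewrite -(hantK_sw' HH HLam Hlam lamLam h (hpair_lform q)) -(q0 (frow (fun a => ev lam (S h *h a)))).
by rewrite conv_hpair; apply: sw_ext => a b; rewrite frowE //; lin.
Qed.

Lemma Lam_nondegl p : (forall q, ev (p *c q) Lam = 0) -> p = 0.
Proof.
move=> p0; apply: eq_hpair => h; rewrite (lform0 (hpair_lform_l h)).
rewrite -(hantK_sw HH HLam Hlam lamLam h (hpair_lform p)) -(p0 (frow (fun b => ev lam (b *h S h)))).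
by rewrite conv_hpair; apply: sw_ext => a b; rewrite frowE //; lin.
Qed.

(** [Lam] is idempotent as [eps Lam = 1], and in characteristic zero an idempotent matrix of trace
    zero vanishes. *)
Lemma Lam_act0 n (rho : 'I_d -> 'M[k]_n) : is_hmod H rho -> ev (hchar rho) Lam = 0 ->
  act rho Lam = 0.
Proof.
move=> [rM _]; rewrite hcharE mxtrace_idem => [/eqP|].
  by rewrite (natr_eq0 Hk) mxrank_eq0 => /eqP.
by rewrite -rM (proj1 (HLam Lam)) epsLam scale1r.
Qed.

Lemma inRH_traceC p x y : inRH H p -> ev p (x *h y) = ev p (y *h x).
Proof.
move: p; apply: inRH_sum => [|a p q pC qC|_ [n [rho [rM _ ->]]]].
- by rewrite !(lform0 (hpair_lform_l _)).
- by rewrite !hpair_lform_l pC qC.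
exact: hchar_traceC.
Qed.

(** As [lam] is the regular character, this form is a coefficient of the regular module against the
    action of [w], which lies in the commutant. *)
Lemma inRH_central w : (forall x, x *h w = w *h x) -> inRH H (frow (fun x => ev lam (w *h x))).
Proof.
move=> wC; have -> : frow (fun x => ev lam (w *h x)) = mcoef (lreg H) (act (lreg H) w).
  apply: eq_hpair => x; rewrite frowE; last by lin.
  rewrite mcoefE -(proj1 (lreg_mod HH)) -hcharE.
  by rewrite (lam_chreg Hk HH Hss HLam Hlam HF0 lamLam).
apply: mcoef_inRH => //; first exact: lreg_mod.
by move=> a; rewrite -(act_ebas (lreg H) a) -!(proj1 (lreg_mod HH)) wC.
Qed.

(** The trace property of [N] makes [z], the element [Lam] acted on by [N], central. Testing against
    central elements [w] then gives the same as testing against all of [H]. *)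
Lemma inRH_nondeg N : inRH H N -> (forall y, inRH H y -> ev (N *c y) Lam = 0) -> N = 0.
Proof.
move=> NR N0; pose z := leftharp H Lam N.
have zE f : lform f -> f z = sw Lam (fun a b => ev N a * f b) by exact: sw_leftharp.
have zC x : x *h z = z *h x.
  apply: eq_hpairr => p; rewrite (zE (fun z => ev p (x *h z))); last by lin.
  rewrite (zE (fun z => ev p (z *h x))); last by lin.
  rewrite (sw_Lam_mulr HH HLam x (F := fun a b => ev N a * ev p b)); last by lin.
  rewrite -{2}(SK x) -(sw_Lam_mull HH HLam (S x) (F := fun a b => ev N a * ev p b)); last by lin.
  by apply: sw_ext => a b; rewrite inRH_traceC.
suff z0 : z = 0.
  by apply: Lam_nondegl => q; rewrite -ev_leftharp -/z z0 (lform0 (hpair_lform q)).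
apply: (ev_lam_nondeg HH HLam Hlam lamLam) => v.
(* The central average [Lam_1 v S(Lam_2)] of [v]. It satisfies [<lam, w z> = <lam, v z>], as [z] is
   central and [S(Lam_2) Lam_1 = 1]. *)
pose w : V := \row_i sw Lam (fun a b => ev (e_ i) (a *h v *h S b)).
have wE f : lform f -> f w = sw Lam (fun a b => f (a *h v *h S b)).
  move=> fP; rewrite (lform_basis w fP).
  under eq_bigr => i _ do rewrite mxE mulrC -swZl.
  rewrite -sw_sum; apply: sw_ext => a b; rewrite [RHS](lform_basis _ fP).
  by apply: eq_bigr => i _; rewrite [ev _ _]hpairC hpairE mulrC.
have wC x : x *h w = w *h x.
  apply: eq_hpairr => p; rewrite (wE (fun w => ev p (x *h w))); last by lin.
  rewrite (wE (fun w => ev p (w *h x))); last by lin.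
  transitivity (sw Lam (fun a b => ev p (x *h a *h v *h S b))).
    by apply: sw_ext => a b; rewrite !(hmulA HH).
  rewrite (sw_Lam_move x (F := fun a b => ev p (a *h v *h S b))); last by lin.
  by apply: sw_ext => a b; rewrite SM SK !(hmulA HH).
have := N0 _ (inRH_central wC); rewrite -ev_leftharp -/z frowE; last by lin.
rewrite (wE (fun w => ev lam (w *h z))); last by lin.
move=> <-; rewrite lamC.
transitivity (sw Lam (fun a b => ev lam (S b *h a *h (z *h v)))).
  rewrite (sw_antipodel' Hk HH Hss HLam Hlam HF0 lamLam Lam (f := fun t => ev lam (t *h (z *h v)))); last by lin.
  by rewrite epsLam mul1r (hmul1l HH).
apply: sw_ext => a b; rewrite (hmulA HH _ _ z) [RHS]lamC -!(hmulA HH).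
by rewrite (hmulA HH (S b) z a) -zC !(hmulA HH).
Qed.

End CharacterRing.

(** * Polynomials in an element of the dual algebra *)

Section PolynomialCalculus.
Variables (k : fieldType) (d : nat) (H : hopf k d.+1).
Local Notation V := 'rV[k]_d.+1.
Local Notation "p *c q" := (conv H p q) (at level 40, left associativity).
Local Notation ev := hpair.
Hypothesis HH : is_hopf H.

(** A faithful matrix model of [H^*]: with row vectors this is an injective algebra morphism, so
    minimal polynomials and ranks of matrices become available. The dimension is [d.+1] so that
    square matrices form a nontrivial ring. *)
Definition convmx (p : V) : 'M[k]_d.+1 := mxl (fun y => leftharp H y p).

Lemma convmxE p q y : ev q (y *m convmx p) = ev (p *c q) y.
Proof. by rewrite mxlE ?ev_leftharp //; exact: leftharp_lin. Qed.

Lemma convmx_lin a p q : convmx (a *: p + q) = a *: convmx p + convmx q.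
Proof.
apply: mxl_inj => y; apply: eq_hpairr => r.
rewrite convmxE mulmxDr -scalemxAr hpair_lform !convmxE conv_linl.
exact: hpair_lform_l.
Qed.

Lemma convmxM p q : convmx (p *c q) = convmx p * convmx q.
Proof.
apply: mxl_inj => y; apply: eq_hpairr => r.
by rewrite mulmxA !convmxE convA.
Qed.

Lemma convmx1 : convmx (heps H) = 1.
Proof. by apply: mxl_inj => y; apply: eq_hpairr => r; rewrite convmxE conv1l // mulmx1. Qed.

Lemma convmx_inj : injective convmx.
Proof.
move=> p q E; apply: eq_hpair => y; rewrite -(conv1r HH p) -(conv1r HH q).
by rewrite -!convmxE E.
Qed.

Lemma convmx0 : convmx 0 = 0.
Proof. by have := convmx_lin (-1) 0 0; rewrite scaler0 addr0 scaleN1r addNr. Qed.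

Lemma convmx_cpow p j : convmx (cpow H p j) = convmx p ^+ j.
Proof.
elim: j => [|j IH]; first by rewrite /cpow /= convmx1 expr0.
by rewrite /cpow iterS -/(cpow H p j) convmxM IH exprSr.
Qed.

(** Only powers below [size P] occur, which is what finally bounds the exponent. *)
Definition cpeval (p : V) (P : {poly k}) : V := \sum_(i < size P) P`_i *: cpow H p i.

Lemma convmx_cpeval p P : convmx (cpeval p P) = horner_mx (convmx p) P.
Proof.
rewrite -{2}[P]coefK poly_def rmorph_sum /= /cpeval.
elim/big_ind2: _ => [|x1 x2 y1 y2 <- <-|i _]; first exact: convmx0.
  by rewrite -[x1 in LHS]scale1r convmx_lin scale1r.
rewrite -[_ *: cpow _ _ _]addr0 convmx_lin convmx0 addr0 convmx_cpow.
by rewrite linearZ /= rmorphXn /= horner_mx_X.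
Qed.

Lemma cpevalM p P Q : cpeval p (P * Q) = cpeval p P *c cpeval p Q.
Proof. by apply: convmx_inj; rewrite convmxM !convmx_cpeval rmorphM. Qed.

Lemma cpevalD p P Q : cpeval p (P + Q) = cpeval p P + cpeval p Q.
Proof.
apply: convmx_inj; rewrite -[cpeval p P]scale1r convmx_lin scale1r.
by rewrite !convmx_cpeval rmorphD.
Qed.

Lemma cpevalZ p a P : cpeval p (a *: P) = a *: cpeval p P.
Proof.
apply: convmx_inj; rewrite -[RHS in _ = convmx RHS]addr0 convmx_lin convmx0 addr0.
by rewrite !convmx_cpeval linearZ.
Qed.

Lemma cpevalX p : cpeval p 'X = p.
Proof. by apply: convmx_inj; rewrite convmx_cpeval horner_mx_X. Qed.

Lemma cpeval_eq0 p P : (cpeval p P == 0) = (mxminpoly (convmx p) %| P).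
Proof.
apply/eqP/mxminpoly_minP => [E|E]; first by rewrite -convmx_cpeval E convmx0.
by apply: convmx_inj; rewrite convmx_cpeval E convmx0.
Qed.

Lemma ev1_cpow p j : ev (cpow H p j) (h1 H) = ev p (h1 H) ^+ j.
Proof.
elim: j => [|j IH]; first by rewrite /cpow /= -hcounitE (hcounit1 HH).
by rewrite /cpow iterS -/(cpow H p j) conv_ev1 // IH exprSr.
Qed.

Lemma ev1_cpeval p P : ev (cpeval p P) (h1 H) = P.[ev p (h1 H)].
Proof.
rewrite horner_coef (lform_sum _ _ _ (hpair_lform_l _)); apply: eq_bigr => i _.
by rewrite (lformZ _ _ (hpair_lform_l _)) ev1_cpow.
Qed.

Lemma convmx_dimFH F : dimFH H F = \rank (convmx F).
Proof.
rewrite -[RHS]mxrank_tr; congr mxrank; apply/matrixP => a b.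
by rewrite [LHS]mxE [RHS]mxE [RHS]mxE -!hpairE hpairC [RHS]hpairC ev_leftharp hpairC.
Qed.

End PolynomialCalculus.

(** * Idempotents and eigenvalues in the character ring *)

Section Spectrum.
Variables (k : closedFieldType) (d : nat) (H : hopf k d.+1).
Local Notation V := 'rV[k]_d.+1.
Local Notation "x *h y" := (hmul H x y) (at level 40, left associativity).
Local Notation "p *c q" := (conv H p q) (at level 40, left associativity).
Local Notation ev := hpair.
Local Notation eps := (hcounit H).
Local Notation e_ := (@ebas k d.+1).
Local Notation S := (hant H).
Local Notation sw := (sw H).

Hypothesis Hk : [pchar k] =i pred0.
Hypothesis HH : is_hopf H.
Hypothesis Hss : semisimple H.
Variables Lam lam : V.
Hypotheses (HLam : is_integral H Lam) (Hlam : is_dual_integral H lam).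
Hypothesis HF0 : (d.+1%:R^-1 *: lam) *c (d.+1%:R^-1 *: lam) = d.+1%:R^-1 *: lam.
Hypothesis lamLam : ev lam Lam = 1.

Let dn0 : d.+1%:R != 0 :> k. Proof. exact: (d_neq0 Hk HH). Qed.

Lemma mxtrace_convmx p : \tr (convmx H p) = d.+1%:R * ev p Lam.
Proof. by rewrite mxtrace_mxl (trl_leftharp Hk HH Hss HLam Hlam HF0 lamLam). Qed.

Lemma ev_convC_Lam p q : ev (p *c q) Lam = ev (q *c p) Lam.
Proof.
apply: (mulfI dn0); rewrite -[LHS]mxtrace_convmx -[RHS]mxtrace_convmx !convmxM //.
exact: mxtrace_mulC.
Qed.

Lemma idem_rank e : e *c e = e -> (\rank (convmx H e))%:R = d.+1%:R * ev e Lam.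
Proof. by move=> ee; rewrite -mxtrace_convmx mxtrace_idem // -[_ *m _]convmxM // ee. Qed.

Lemma idem_Lam_neq0 e : e *c e = e -> e != 0 -> ev e Lam != 0.
Proof.
move=> ee; apply: contra => /eqP e0; have := idem_rank ee.
rewrite e0 mulr0 => /eqP; rewrite natr_eq0 // mxrank_eq0 => /eqP E.
by apply/eqP/(convmx_inj HH); rewrite E convmx0.
Qed.

Lemma ev_hEta F p a : F *c F = F -> F != 0 -> F *c p = a *: F ->
  ev p (hEta H Lam F) = a.
Proof.
move=> FF F0 Fp; rewrite /hEta (lformZ _ _ (hpair_lform p)) ev_leftharp.
rewrite (lmapZ _ _ (conv_linl H p)) Fp !(lformZ _ _ (hpair_lform_l Lam)).
rewrite convmx_dimFH // (idem_rank FF).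
by rewrite (mulrCA d.+1%:R a) (mulrCA _ a) mulVf ?mulr1 // mulf_neq0 // idem_Lam_neq0.
Qed.

Lemma ev_lam1_conv p : p *c lam = ev p (h1 H) *: lam. Proof. by case: (Hlam p). Qed.
Lemma lam_conv p : lam *c p = ev p (h1 H) *: lam. Proof. by case: (Hlam p). Qed.

Hypothesis Hcomm : forall p q, inRH H p -> inRH H q -> p *c q = q *c p.

Lemma inRH_conv p q : inRH H p -> inRH H q -> inRH H (p *c q).
Proof.
move=> pR qR; move: p pR; apply: inRH_sum => [|a p p' pR p'R|_ [n [rho [rM _ ->]]]].
- by rewrite (lmap0 (conv_linl H q)); exact: inRH0.
- by rewrite conv_linl; apply: inRHD => //; apply: inRHZ.
move: q qR; apply: inRH_sum => [|a p p' pR p'R|_ [m [mu [mM _ ->]]]].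
- by rewrite (lmap0 (conv_linr H _)); exact: inRH0.
- by rewrite conv_linr; apply: inRHD => //; apply: inRHZ.
by rewrite -hchar_tens; apply: hchar_inRH => //; apply: tens_mod.
Qed.

(** By commutativity [N y] also has square zero for every [y] in [R(H)], so its trace [d <N y, Lam>]
    vanishes and nondegeneracy applies. *)
Lemma inRH_reduced N : inRH H N -> N *c N = 0 -> N = 0.
Proof.
move=> NR NN; apply: (inRH_nondeg Hk HH Hss HLam Hlam HF0 lamLam) => // y yR.
apply: (mulfI dn0); rewrite mulr0 -mxtrace_convmx; apply: mxtrace_sqr0.
rewrite -[_ *m _]convmxM // (_ : _ *c _ = 0) ?convmx0 //.
rewrite -(convA HH) (Hcomm yR) ?(convA HH); last exact: inRH_conv.
by rewrite -(convA HH N) (convA HH N) NN (lmap0 (conv_linl H _)) (lmap0 (conv_linl H _)).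
Qed.

(** Descent on the rank: if [E] is not primitive, it has a proper nonzero subidempotent [E'], and
    the rank of [E] is that of [E'] plus that of [E - E']. *)
Lemma prim_idem_exists E : inRH H E -> E *c E = E -> E != 0 ->
  exists2 F, prim_idem H F & F *c E = F.
Proof.
have [m] := ubnP (\rank (convmx H E)); elim: m E => // m IH E /ltnSE leE ER EE E0.
have [prim|nprim] := classic (prim_idem H E); first by exists E.
have [E' [E'R E'E' E'E E'0 E'nE]] : exists E', [/\ inRH H E', E' *c E' = E', E' *c E = E',
    E' <> 0 & E' <> E].
  apply: NNPP => no; apply: nprim; split=> // [q qR|E' E'R E'E' E'E]; first exact: Hcomm.
  by apply: NNPP => n0; apply: no; exists E'; split=> // ?; apply: n0; [left|right].
have EE' : E *c E' = E' by rewrite Hcomm.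
pose D := E - E'.
have DD : D *c D = D.
  rewrite /D !(lmapB _ _ (conv_linl H _)) !(lmapB _ _ (conv_linr H _)).
  by rewrite EE E'E EE' E'E' subrr subr0.
have D0 : D != 0 by rewrite subr_eq0 eq_sym; apply/eqP.
have rD : (\rank (convmx H E') + \rank (convmx H D) = \rank (convmx H E))%N.
  apply: (natr_inj Hk); rewrite natrD !idem_rank // /D.
  by rewrite (lformB _ _ (hpair_lform_l _)); ring.
have rD0 : (0 < \rank (convmx H D))%N.
  rewrite lt0n mxrank_eq0; apply: contra D0 => /eqP E0'.
  by apply/eqP/(convmx_inj HH); rewrite E0' convmx0.
have [||F Fp FE'] := IH E' _ E'R E'E'.
- by lia.
- by apply/eqP.
by exists F => //; rewrite -FE' -(convA HH) E'E.
Qed.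

Variables (n : nat) (rho : 'I_d.+1 -> 'M[k]_n).
Hypothesis Hrho : is_hmod H rho.
Local Notation chi := (hchar rho).

Lemma cpow_module j : exists m (X : 'I_d.+1 -> 'M[k]_m), is_hmod H X /\ hchar X = cpow H chi j.
Proof.
elim: j => [|j [m [X [XM XE]]]].
  by exists 1%N, (triv H); split; [exact: triv_mod | exact: hchar_triv].
exists (m * n)%N, (tens H X rho); split; first exact: tens_mod.
by rewrite hchar_tens XE.
Qed.

Lemma cpeval_inRH P : inRH H (cpeval H chi P).
Proof.
rewrite /cpeval; elim/big_ind: _ => [|p q|i _]; [exact: inRH0 | exact: inRHD |].
have [m [X [XM <-]]] := cpow_module i; apply: inRHZ; exact: hchar_inRH.
Qed.

(** With minimal polynomial [q (X - z)], the element [y = q(chi)] is a nonzero eigenvector and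
    [y^2 = q(z) y]. Reducedness gives [q(z) <> 0], so the root is simple, and [chi] acts by [z] on
    any primitive idempotent below [y / q(z)]. *)
Lemma mxminpoly_root_eta z : root (mxminpoly (convmx H chi)) z ->
  (exists2 F, prim_idem H F & z = ev chi (hEta H Lam F))
  /\ exists2 q, mxminpoly (convmx H chi) = q * ('X - z%:P) & ~~ root q z.
Proof.
move/factor_theorem => [q pq]; set p := mxminpoly _ in pq.
pose y := cpeval H chi q.
have q0 : q != 0.
  by apply: contraTneq (monic_neq0 (mxminpoly_monic (convmx H chi))) => q0; rewrite -/p pq q0 mul0r eqxx.
have y0 : y != 0.
  rewrite cpeval_eq0 // -/p; apply/negP => /(dvdp_leq q0).
  by rewrite pq size_Mmonic ?monicXsubC // size_XsubC addn2 /= ltnn.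
have ev_mod r : y *c cpeval H chi r = r.[z] *: y.
  apply/eqP; rewrite -subr_eq0.
  have -> : y *c cpeval H chi r - r.[z] *: y = cpeval H chi (q * r - r.[z] *: q).
    by rewrite -!scaleNr cpevalD // cpevalM // cpevalZ.
  rewrite cpeval_eq0 // -/p pq -mul_polyC [_ * q]mulrC -mulrBr.
  by apply: dvdp_mul => //; rewrite dvdp_XsubCl rootE !hornerE subrr.
have yR : inRH H y by exact: cpeval_inRH.
have yy : y *c y = q.[z] *: y by exact: ev_mod.
have qz : q.[z] != 0.
  apply: contraNneq y0 => qz; apply/eqP/inRH_reduced => //.
  by rewrite yy qz scale0r.
split; last by exists q.
pose E := q.[z]^-1 *: y.
have [|||F Fp FE] := @prim_idem_exists E _ _ _.
- exact: inRHZ.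
- rewrite /E (lmapZ _ _ (conv_linl H _)) (lmapZ _ _ (conv_linr H _)) yy.
  by rewrite [X in _ *: X]scalerA mulVf // scale1r.
- by rewrite scaler_eq0 invr_eq0 negb_or qz.
exists F => //; case: Fp => FR FF F0 _ _; apply/esym/ev_hEta => //.
rewrite -{1}FE -(convA HH) -[X in E *c X](cpevalX HH) /E (lmapZ _ _ (conv_linl H _)).
rewrite ev_mod hornerX scalerA mulrC -scalerA (lmapZ _ _ (conv_linr H _)).
by rewrite -/E FE.
Qed.

(** The minimal polynomial of [chi] has simple roots, all of them in [s], so it divides the
    product. *)
Lemma prod_chi_eq0 (s : seq k) :
  (forall F, prim_idem H F -> ev chi (hEta H Lam F) \in s) ->
  cpeval H chi (\prod_(z <- s) ('X - z%:P)) = 0.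
Proof.
move=> sP; apply/eqP; rewrite cpeval_eq0 //.
set p := mxminpoly _.
have [r pr] := closed_field_poly_normal p.
have lc1 : lead_coef p = 1 by apply/eqP/mxminpoly_monic.
rewrite lc1 scale1r in pr.
have rP z : z \in r -> root p z by rewrite pr root_prod_XsubC.
rewrite pr; apply: uniq_roots_dvdp.
  apply/allP => z /rP pz; rewrite root_prod_XsubC.
  by have [[F Fp ->] _] := mxminpoly_root_eta pz; apply: sP.
rewrite uniq_rootsE; apply: count_mem_uniq => z.
have [zr|/count_memPn //] := boolP (z \in r).
have [_ [q pq nq]] := mxminpoly_root_eta (rP z zr).
rewrite -/p in pq.
have qr : q = \prod_(x <- rem z r) ('X - x%:P).
  apply: (mulIf (monic_neq0 (monicXsubC z))); rewrite -pq pr.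
  by rewrite (perm_big _ (perm_to_rem zr)) big_cons mulrC.
move: nq; rewrite qr root_prod_XsubC => /count_memPn.
by rewrite (permP (perm_to_rem zr)) /= eqxx => ->.
Qed.

(** An idempotent [E] below [lam / d] equals [E(1)] times it, and [E(1)] is [0] or [1]. *)
Lemma lam_prim_idem : prim_idem H (d.+1%:R^-1 *: lam).
Proof.
have lamR : inRH H lam.
  rewrite (lam_chreg Hk HH Hss HLam Hlam HF0 lamLam).
  by apply: hchar_inRH => //; exact: lreg_mod.
have FR := inRHZ d.+1%:R^-1 lamR.
split=> // [|q qR|E ER EE].
- rewrite scaler_eq0 invr_eq0 negb_or dn0; apply/eqP => l0.
  by move/eqP: lamLam; rewrite l0 (lform0 (hpair_lform_l _)) eq_sym; exact/negP/oner_neq0.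
- exact: Hcomm.
rewrite (lmapZ _ _ (conv_linr H _)) ev_lam1_conv scalerA mulrC -scalerA => El.
have := conv_ev1 HH E E; rewrite EE => /eqP.
rewrite -{1}[ev E _]mulr1 -subr_eq0 -mulrBr mulf_eq0 subr_eq0 => /orP [/eqP e0|/eqP e1].
  by left; rewrite -El e0 scale0r.
by right; rewrite -El -e1 scale1r.
Qed.

Lemma chi_lam_eta : ev chi (hEta H Lam (d.+1%:R^-1 *: lam)) = n%:R.
Proof.
case: lam_prim_idem => _ FF F0 _ _; apply: ev_hEta => //.
by rewrite (lmapZ _ _ (conv_linl H _)) lam_conv hchar1 // !scalerA mulrC.
Qed.

End Spectrum.

(** * Faithful modules *)

(** Vectors satisfying [P] are adjoined to a row space until it is exhausted; the rank bounds the
    process. This gives [inB] below a basis. *)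
Lemma subspace_mx (k : fieldType) d (P : 'rV[k]_d -> Prop) :
  P 0 -> (forall a p q, P p -> P q -> P (a *: p + q)) ->
  exists B : 'M[k]_d, forall p, P p <-> (p <= B)%MS.
Proof.
move=> P0 PD.
have ext (B : 'M[k]_d) : (forall p, (p <= B)%MS -> P p) ->
    exists B' : 'M[k]_d, forall p, P p <-> (p <= B')%MS.
  have [m] := ubnP (d - \rank B); elim: m B => // m IH B /ltnSE leB BP.
  have [Ball|] := classic (forall p, P p -> (p <= B)%MS).
    by exists B => p; split; [exact: Ball | exact: BP].
  move=> /not_all_ex_not [p np]; have [Pp /negP pB] := imply_to_and _ _ np.
  apply: (IH (B + p)%MS); last first.
    move=> q /sub_addsmxP [[u v] /= ->]; rewrite addrC.
    rewrite [v]mx11_scalar mul_scalar_mx; apply: PD => //.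
    by apply: BP; exact: submxMl.
  have : (\rank B < \rank (B + p)%MS)%N.
    apply: rank_ltmx; rewrite ltmxE addsmxSl /=; apply: contra pB.
    exact: submx_trans (addsmxSr _ _).
  have := rank_leq_col (B + p)%MS; lia.
by apply: (ext 0) => p; rewrite submx0 => /eqP ->.
Qed.

Section Faithful.
Variables (k : closedFieldType) (d : nat) (H : hopf k d.+1).
Local Notation V := 'rV[k]_d.+1.
Local Notation "x *h y" := (hmul H x y) (at level 40, left associativity).
Local Notation "p *c q" := (conv H p q) (at level 40, left associativity).
Local Notation ev := hpair.
Local Notation eps := (hcounit H).
Local Notation e_ := (@ebas k d.+1).
Local Notation S := (hant H).
Local Notation sw := (sw H).

Hypothesis Hk : [pchar k] =i pred0.
Hypothesis HH : is_hopf H.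
Hypothesis Hss : semisimple H.
Variables Lam lam : V.
Hypotheses (HLam : is_integral H Lam) (Hlam : is_dual_integral H lam).
Hypothesis HF0 : (d.+1%:R^-1 *: lam) *c (d.+1%:R^-1 *: lam) = d.+1%:R^-1 *: lam.
Hypothesis lamLam : ev lam Lam = 1.

Definition rtrans (x : V) (p : V) : V := frow (fun y => ev p (y *h x)).

Lemma rtransE x p y : ev (rtrans x p) y = ev p (y *h x).
Proof. by rewrite frowE //; lin. Qed.

(* A nonzero p in the radical would have a translate p' in it with p'(1) <> 0; some
   polynomial without constant term in p' is then an idempotent e with e(1) = 1, and
   the trace of e, a nonzero rank, is a multiple of <e, Lam> = 0. *)
Lemma subalgebra_nondeg (B : V -> Prop) : B (heps H) ->
  (forall a p q, B p -> B q -> B (a *: p + q)) -> (forall p q, B p -> B q -> B (p *c q)) ->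
  (forall x p, B p -> B (rtrans x p)) ->
  forall p, B p -> (forall q, B q -> ev (p *c q) Lam = 0) -> p = 0.
Proof.
move=> B1 BD BM Bt p Bp p0; apply: eq_hpair => x; rewrite (lform0 (hpair_lform_l x)).
apply/eqP/negPn/negP => px.
pose p' := rtrans x p; have Bp' : B p' by exact: Bt.
have p'0 q : B q -> ev (p' *c q) Lam = 0.
  move=> Bq; rewrite -(p0 (rtrans (S x) q)); last exact: Bt.
  rewrite !conv_hpair.
  transitivity (sw Lam (fun a b => ev p (a *h x) * ev q b)).
    by apply: sw_ext => a b; rewrite rtransE.
  rewrite (sw_Lam_mull HH HLam x (F := fun a b => ev p a * ev q b)); last by lin.
  by apply: sw_ext => a b; rewrite rtransE.
have p'1 : ev p' (h1 H) = ev p x by rewrite rtransE (hmul1l HH).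
have Bpow P : B (cpeval H p' P).
  have B0 : B 0 by rewrite -(addNr (heps H)) -scaleN1r; apply: BD.
  rewrite /cpeval; elim/big_ind: _ => // [u v Bu Bv|i _].
    by rewrite -[u]scale1r; apply: BD.
  rewrite -[_ *: _]addr0; apply: BD => //; elim: (i : nat) => // j IH.
  by rewrite /cpow iterS -/(cpow H p' j); apply: BM.
set mp := mxminpoly (convmx H p').
have [m [q nq mpq]] := multiplicity_XsubC mp 0.
have mp0 : mp != 0 by exact/monic_neq0/mxminpoly_monic.
rewrite mp0 /= in nq; rewrite subr0 in mpq.
(* Here [X^m] is the exact power of [X] in the minimal polynomial. The exponent [m.+1] ensures that
   [e] has no constant term even when [m = 0], so that [p'] factors out of [e]. *)
have : coprimep ('X^(m.+1)) q.
  apply: coprimep_expl; rewrite coprimep_sym -['X]subr0 -[0]/(0%:P) coprimep_XsubC.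
  exact: nq.
case/Bezout_eq1_coprimepP => [[u v] /= uv].
pose e := cpeval H p' (u * 'X^(m.+1)).
have ee : e *c e = e.
  apply/eqP; rewrite -subr_eq0 -cpevalM // -scaleN1r -cpevalZ // -cpevalD //.
  rewrite cpeval_eq0 // -/mp mpq scaleN1r.
  have -> : u * 'X^(m.+1) * (u * 'X^(m.+1)) - u * 'X^(m.+1) = q * 'X^m * (- (u * v * 'X)).
    have -> : u * 'X^(m.+1) * (u * 'X^(m.+1)) - u * 'X^(m.+1) = - (u * 'X^(m.+1)) * (1 - u * 'X^(m.+1)).
      by ring.
    by rewrite -{1}uv exprSr; ring.
  exact: dvdp_mulr.
(* Evaluation at [1] is an algebra morphism, so [p'(1)] is a root of the minimal polynomial; being
   nonzero, it is a root of [q]. *)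
have q1 : q.[ev p x] = 0.
  have : cpeval H p' mp = 0 by apply/eqP; rewrite cpeval_eq0.
  move/(congr1 (fun r => ev r (h1 H))); rewrite ev1_cpeval // (lform0 (hpair_lform_l _)) p'1.
  by rewrite mpq !hornerE => /eqP; rewrite mulf_eq0 expf_eq0 (negPf px) andbF orbF => /eqP.
have e1 : ev e (h1 H) = 1.
  rewrite /e ev1_cpeval // p'1; have := congr1 (fun r : {poly k} => r.[ev p x]) uv.
  by rewrite /= !hornerE q1 mulr0 addr0.
have e0 : e != 0.
  by apply/eqP => e0; move/eqP: e1; rewrite e0 (lform0 (hpair_lform_l _)) eq_sym (negPf (oner_neq0 _)).
have := idem_Lam_neq0 Hk HH Hss HLam Hlam HF0 lamLam ee e0.
rewrite /e exprS mulrCA cpevalM // cpevalX // p'0 ?eqxx //.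
Qed.

Variables (n : nat) (rho : 'I_d.+1 -> 'M[k]_n).
Hypothesis Hrho : is_hmod H rho.
Local Notation chi := (hchar rho).

(* The subalgebra of H^* generated by the matrix coefficients of rho; an H-module with
   character chi^l has the same matrix coefficients as the l-th tensor power of rho. *)
Inductive inB : V -> Prop :=
| inB_coef l m (X : 'I_d.+1 -> 'M[k]_m) T :
    is_hmod H X -> hchar X = cpow H chi l -> inB (mcoef X T)
| inB_lin a p q : inB p -> inB q -> inB (a *: p + q).

Lemma inB1 : inB (heps H).
Proof.
rewrite -hchar_triv -mcoef1; apply: (@inB_coef 0%N); first exact: triv_mod.
by rewrite hchar_triv.
Qed.

Lemma inB0 : inB 0.
Proof. by rewrite -(addNr (heps H)) -scaleN1r; apply: inB_lin inB1 inB1. Qed.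

Lemma cpow_add l m : cpow H chi l *c cpow H chi m = cpow H chi (l + m).
Proof.
elim: m => [|m IH]; first by rewrite addn0 /= conv1r.
by rewrite addnS /cpow !iterS -!/(cpow _ _ _) (convA HH) IH.
Qed.

Lemma inB_conv p q : inB p -> inB q -> inB (p *c q).
Proof.
move=> Bp; elim: Bp q => {p} [l m X T XM XE|a p p' _ IH _ IH'] q Bq; last first.
  by rewrite conv_linl; apply: inB_lin; [apply: IH|apply: IH'].
elim: Bq => {q} [l' m' Y T' YM YE|a q q' _ IH _ IH']; last first.
  by rewrite conv_linr; apply: inB_lin.
rewrite -mcoef_tens; apply: (@inB_coef (l + l')); first exact: tens_mod.
by rewrite hchar_tens XE YE cpow_add.
Qed.

Lemma inB_rtrans x p : inB p -> inB (rtrans x p).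
Proof.
elim=> {p} [l m X T XM XE|a p p' _ IH _ IH'].
  have -> : rtrans x (mcoef X T) = mcoef X (act X x *m T).
    apply: eq_hpair => y; rewrite rtransE !mcoefE; case: XM => -> _.
    by rewrite mulmxA mxtrace_mulC mulmxA.
  exact: inB_coef XE.
have -> : rtrans x (a *: p + p') = a *: rtrans x p + rtrans x p'.
  by apply: eq_hpair => y; rewrite rtransE !hpair_lform_l !rtransE.
exact: inB_lin.
Qed.

Let nondegB := subalgebra_nondeg inB1 inB_lin inB_conv inB_rtrans.

(** The Gram matrix of the form on a basis of [inB] is invertible, so evaluation at [1] is
    represented by an element [b]. *)
Lemma inB_integral : exists2 b, inB b & forall p, inB p -> ev (p *c b) Lam = ev p (h1 H).
Proof.
have [B BP] := subspace_mx inB0 inB_lin.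
pose R := row_base B.
have RB u : inB (u *m R) by apply/BP; rewrite -(eq_row_base B) submxMl.
have BR p : inB p -> exists u, p = u *m R.
  by move/BP; rewrite -(eq_row_base B) => /submxP [u ->]; exists u.
pose G : 'M[k]_d.+1 := \matrix_(i, j) ev (e_ i *c e_ j) Lam.
have GE p q : (p *m G *m q^T) 0 0 = ev (p *c q) Lam.
  move: p; apply: eq_lform => [a u v|a u v|i].
  - by rewrite !mulmxDl -!scalemxAl !mxE.
  - by rewrite conv_linl hpair_lform_l.
  move: q; apply: eq_lform => [a u v|a u v|j].
  - by rewrite linearD linearZ mulmxDr -scalemxAr !mxE.
  - by rewrite conv_linr hpair_lform_l.
  by rewrite /ebas trmx_delta -rowE -colE !mxE.
pose A := R *m G *m R^T.
have AE u w : ev ((u *m R) *c (w *m R)) Lam = (u *m A *m w^T) 0 0.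
  by rewrite -GE trmx_mul /A !mulmxA.
have Aunit : A \in unitmx.
  rewrite -row_free_unit -kermx_eq0; apply/eqP/row_matrixP => i; rewrite row0.
  set u := row i _; have uA : u *m A = 0 by rewrite /u -row_mul mulmx_ker row0.
  have uR : u *m R = 0.
    by apply: nondegB => // q /BR [w ->]; rewrite AE uA mul0mx mxE.
  by apply: (row_free_inj (row_base_free B)); rewrite mul0mx.
exists ((invmx A *m (R *m (h1 H)^T))^T *m R) => // p /BR [u ->].
rewrite AE trmxK mulmxA mulmxK // mulmxA mxE.
by apply: eq_bigr => i _; rewrite [(_)^T i 0]mxE.
Qed.

Hypothesis Hfaith : faithful_char H rho.

Lemma lam_inB : inB lam.
Proof.
have [b Bb bP] := inB_integral.
have bq q : inB q -> q *c b = ev q (h1 H) *: b.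
  move=> Bq; apply/eqP; rewrite -subr_eq0; apply/eqP; apply: nondegB.
    by rewrite -scaleNr addrC; apply: inB_lin Bb (inB_conv Bq Bb).
  move=> r Br; rewrite (ev_convC_Lam Hk HH Hss HLam Hlam HF0 lamLam).
  rewrite (lmapB _ _ (conv_linr H _)) (lformB _ _ (hpair_lform_l _)) (convA HH).
  rewrite (lmapZ _ _ (conv_linr H _)) (lformZ _ _ (hpair_lform_l _)) !bP //; last exact: inB_conv.
  by rewrite conv_ev1 // mulrC subrr.
(* [h = Lam_1 <b, Lam_2>]. Since [q b = q(1) b] for every matrix coefficient [q] of [rho], it lies
   in the kernel [LKer]. *)
pose h : V := \row_i ev (e_ i *c b) Lam.
have hE p : ev p h = ev (p *c b) Lam.
  rewrite (lform_basis p (f := fun p => ev (p *c b) Lam)); last first.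
    by move=> a u v; rewrite conv_linl hpair_lform_l.
  by apply: eq_bigr => i _; rewrite mxE.
have [c hc] : exists c, h = c *: h1 H.
  apply/Hfaith => i; apply/matrixP => u v.
  pose q := mcoef rho (delta_mx v u).
  have qE x : ev q x = act rho x u v.
    rewrite mcoefE /mxtrace (bigD1 v) //= big1 ?addr0 => [|w wv].
      rewrite mxE (bigD1 u) //= big1 ?addr0 => [|w wu]; first by rewrite mxE !eqxx mul1r.
      by rewrite mxE (negPf wu) andbF mul0r.
    by rewrite mxE big1 // => w' _; rewrite mxE (negPf wv) mul0r.
  have qB : inB q.
    by apply: (@inB_coef 1%N) => //; rewrite /cpow /= conv1l.
  transitivity (ev (e_ i *c q) h).
    rewrite conv_hpair /sw [RHS](bigD1 i) //= [X in _ = _ + X]big1 ?addr0.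
      rewrite summxE; apply: eq_bigr => w _.
      by rewrite mxE hpairE ebasE eqxx mul1r qE act_ebas.
    by move=> w wi; rewrite big1 // => w' _; rewrite hpairE ebasE (negPf wi) mul0r mulr0.
  rewrite hE -(convA HH) bq // (lmapZ _ _ (conv_linr H _)) (lformZ _ _ (hpair_lform_l _)).
  rewrite qE (proj2 Hrho) -hE hpairC hpairE [RHS]mxE mulrC //.
(* Both sides have the same pairing [c p(1)] with every [p] in [H^*]. *)
have blam : b = c *: lam.
  apply: eq_hpair => x; apply/eqP; rewrite -subr_eq0 -(lformB _ _ (hpair_lform_l _)).
  suff -> : b - c *: lam = 0 by rewrite (lform0 (hpair_lform_l _)).
  apply: (Lam_nondegr HH HLam Hlam lamLam) => p.
  rewrite (lmapB _ _ (conv_linr H _)) (lformB _ _ (hpair_lform_l _)) -hE hc.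
  rewrite (lmapZ _ _ (conv_linr H _)) (proj1 (Hlam p)).
  rewrite !(lformZ _ _ (hpair_lform_l _)) (lformZ _ _ (hpair_lform _)) lamLam; ring.
have c0 : c != 0.
  apply/eqP => c0; have := bP _ inB1; rewrite blam c0 scale0r conv1l //.
  rewrite (lform0 (hpair_lform_l _)) -hcounitE (hcounit1 HH) => /eqP.
  by rewrite eq_sym (negPf (oner_neq0 _)).
rewrite -[lam]scale1r -(mulVf c0) -scalerA -blam -[_ *: b]addr0.
by apply: inB_lin => //; exact: inB0.
Qed.

(** Otherwise [Lam] acts as zero on each power tensored with [mu], so [mu] is orthogonal to all of
    [inB], which contains [lam]; but [lam] pairs with [mu] to the dimension [m]. *)
Lemma irr_in_power m (mu : 'I_d.+1 -> 'M[k]_m) : is_hmod H mu -> (0 < m)%N ->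
  exists l, ev (cpow H chi l *c hchar mu) Lam != 0.
Proof.
move=> mM m_gt0; apply: NNPP => no.
have no0 l : ev (cpow H chi l *c hchar mu) Lam = 0.
  by apply/eqP/negPn/negP => l0; apply: no; exists l.
have B0 b : inB b -> ev (b *c hchar mu) Lam = 0.
  elim=> {b} [l m' X T XM XE|a p q _ IHp _ IHq]; last first.
    by rewrite conv_linl hpair_lform_l IHp IHq mulr0 addr0.
  rewrite -[hchar mu]mcoef1 -mcoef_tens mcoefE.
  rewrite (Lam_act0 Hk HH Hss HLam Hlam HF0 lamLam) ?mulmx0 ?mxtrace0 //.
    exact: tens_mod.
  by rewrite hchar_tens XE no0.
have := B0 _ lam_inB; rewrite (proj2 (Hlam _)) (lformZ _ _ (hpair_lform_l _)) lamLam mulr1.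
by rewrite (hchar1 mM) => /eqP; rewrite (natr_eq0 Hk); lia.
Qed.

End Faithful.

(** * A Perron-Frobenius argument for nonnegative integer matrices *)

Section PerronFrobenius.
Variables (r n : nat) (A : 'I_r -> 'I_r -> nat) (w : 'I_r -> nat) (Z : pred 'I_r).
Hypothesis w_gt0 : forall j, (0 < w j)%N.
Hypothesis Aw : forall j, (\sum_i A j i * w i = n * w j)%N.
(** From every index the arrows of [A] lead into [Z]. In the application the indices are the
    irreducible characters, [A] gives multiplicities in products with [chi], [w] the dimensions, and
    [Z] marks the trivial character. *)
Hypothesis reach : forall (U : {set 'I_r}) j0, j0 \in U ->
  (forall j i, j \in U -> (0 < A j i)%N -> i \in U) -> exists2 j, j \in U & Z j.

(** Maximum principle: the set [U] where [|v_j| / w_j] is maximal is closed under arrows, so it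
    meets [Z], where [v] vanishes. *)
Lemma pf_rat (v : 'I_r -> rat) : (forall j, ~~ Z j -> \sum_i (A j i)%:R * v i = n%:R * v j) ->
  (forall j, Z j -> v j = 0) -> forall j, v j = 0.
Proof.
move=> Av vZ j0; apply/eqP/negPn/negP => vj0.
pose F j := `|v j| / (w j)%:R.
have wQ j : 0 < (w j)%:R :> rat by rewrite ltr0n.
case: (@arg_maxP _ _ _ j0 predT F isT) => jm _ Fmax.
pose m := F jm.
have m_gt0 : 0 < m.
  by apply: lt_le_trans (Fmax j0 isT); rewrite divr_gt0 // normr_gt0.
have vm j : `|v j| <= m * (w j)%:R by rewrite -ler_pdivrMr //; exact: Fmax.
pose U := [set j | `|v j| == m * (w j)%:R].
have jmU : jm \in U by rewrite inE /m /F divfK // gt_eqF.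
have [|j jU Zj] := reach jmU.
  move=> j i; rewrite inE => /eqP vj Aji; have nZ : ~~ Z j.
    apply/negP => /vZ vj0'; move/eqP: vj; rewrite vj0' normr0 eq_sym.
    by rewrite mulf_eq0 !gt_eqF.
  have terms_ge0 l : true -> 0 <= (A j l)%:R * (m * (w l)%:R - `|v l|).
    by move=> _; rewrite mulr_ge0 // subr_ge0.
  (* The triangle inequality bounds this sum of nonnegative terms by zero, so an arrow from [j] to
     [i] forces equality at [i]. *)
  have : \sum_l (A j l)%:R * (m * (w l)%:R - `|v l|) = 0.
    apply/eqP; rewrite eq_le sumr_ge0 ?andbT //.
    under eq_bigr => l _ do rewrite mulrBr mulrCA.
    rewrite big_split /= -mulr_sumr sumrN subr_le0.
    have -> : \sum_i (A j i)%:R * (w i)%:R = n%:R * (w j)%:R :> rat.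
      by rewrite -natrM -Aw natr_sum; apply: eq_bigr => l _; rewrite natrM.
    rewrite mulrCA -vj -[n%:R in X in X <= _](normr_nat rat) -normrM -Av //.
    apply: le_trans (ler_norm_sum _ _ _) _.
    by apply: ler_sum => l _; rewrite normrM normr_nat.
  move/(psumr_eq0P terms_ge0) => /(_ i isT) /eqP; rewrite mulf_eq0 pnatr_eq0.
  by rewrite eqn0Ngt Aji /= subr_eq0 eq_sym inE.
by move: jU; rewrite inE vZ // normr0 eq_sym mulf_eq0 !gt_eqF.
Qed.

(* The system has an integral matrix; injectivity over rat makes its determinant a
   nonzero integer, which stays nonzero in k. *)
Lemma pf_char0 (k : fieldType) (c : 'I_r -> k) : [pchar k] =i pred0 ->
  (forall j, ~~ Z j -> \sum_i (A j i)%:R * c i = n%:R * c j) ->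
  (forall j, Z j -> c j = 0) -> forall j, c j = 0.
Proof.
move=> Hk Ac cZ.
pose T : 'M[int]_r := \matrix_(i, j)
  if Z j then (i == j)%:R else n%:R * (i == j)%:R - (A j i)%:R.
have TE (R : comNzRingType) (u : 'rV[R]_r) j :
    (u *m map_mx intr T) 0 j
    = if Z j then u 0 j else n%:R * u 0 j - \sum_i (A j i)%:R * u 0 i.
  rewrite mxE; case: ifP => Zj.
    rewrite (bigD1 j) //= big1 ?addr0 => [|i ij]; rewrite !mxE Zj ?eqxx ?mulr1 //.
    by rewrite (negPf ij) mulr0.
  transitivity (\sum_i (n%:R * ((i == j)%:R * u 0 i) - (A j i)%:R * u 0 i)).
    apply: eq_bigr => i _; rewrite !mxE Zj rmorphB rmorphM /= !rmorph_nat; ring.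
  rewrite sumrB -mulr_sumr; congr (_ * _ - _).
  rewrite (bigD1 j) //= eqxx mul1r big1 ?addr0 // => i ij.
  by rewrite (negPf ij) mul0r.
have detT : \det T != 0.
  apply/negP => /eqP dT.
  have /det0P [v v0 vT] : \det (map_mx intr T : 'M[rat]_r) == 0.
    by rewrite det_map_mx dT rmorph0.
  case/eqP: v0; apply/rowP => j; rewrite [RHS]mxE; move: j.
  apply: pf_rat => [j nZ|j Zj].
    have := TE _ v j; rewrite vT mxE (negPf nZ) => /eqP.
    by rewrite eq_sym subr_eq0 => /eqP ->.
  by have := TE _ v j; rewrite vT mxE Zj.
have detk : map_mx intr T \in (unitmx : {pred 'M[k]_r}).
  rewrite unitmxE det_map_mx unitfE; case: (\det T) detT => m m0 /=.
    by rewrite (natr_eq0 Hk).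
  by rewrite NegzE mulrNz oppr_eq0 (natr_eq0 Hk).
pose u := \row_j c j.
have uT : u *m map_mx intr T = 0.
  apply/rowP => j; rewrite TE [RHS]mxE; case: ifP => [Zj|/negbT nZ].
    by rewrite mxE cZ.
  under eq_bigr => i _ do rewrite mxE.
  by rewrite Ac // mxE subrr.
move=> j; have : u = 0 by rewrite -[u](mulmxK detk) uT mul0mx.
by move/rowP/(_ j); rewrite !mxE.
Qed.

End PerronFrobenius.

(** * Irreducible characters and the top eigenspace of the faithful character *)

Section Powers.
Variables (k : closedFieldType) (d : nat) (H : hopf k d.+1).
Local Notation V := 'rV[k]_d.+1.
Local Notation "x *h y" := (hmul H x y) (at level 40, left associativity).
Local Notation "p *c q" := (conv H p q) (at level 40, left associativity).
Local Notation ev := hpair.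
Local Notation S := (hant H).

Hypothesis Hk : [pchar k] =i pred0.
Hypothesis HH : is_hopf H.
Hypothesis Hss : semisimple H.
Variables Lam lam : V.
Hypotheses (HLam : is_integral H Lam) (Hlam : is_dual_integral H lam).
Hypothesis HF0 : (d.+1%:R^-1 *: lam) *c (d.+1%:R^-1 *: lam) = d.+1%:R^-1 *: lam.
Hypothesis lamLam : ev lam Lam = 1.
Variables (n : nat) (rho : 'I_d.+1 -> 'M[k]_n).
Hypothesis Hrho : is_hmod H rho.
Hypothesis Hfaith : faithful_char H rho.
Local Notation chi := (hchar rho).

(** [p(x) = p(x 1)] is the coefficient given by the rank-one matrix pairing [p] with the unit. *)
Lemma mcoef_lreg_surj p : exists T, p = mcoef (lreg H) T.
Proof.
exists ((h1 H)^T *m p); apply: eq_hpair => x.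
rewrite mcoefE -mulmxA mxtrace_mulC /mxtrace big_ord1 -mulmxA.
have -> : act (lreg H) x *m (h1 H)^T = x^T.
  by rewrite -[RHS](congr1 trmx (hmul1r HH x)) -act_lreg trmx_mul trmxK.
by rewrite mxE; apply: eq_bigr => i _; rewrite [x^T _ _]mxE.
Qed.

(** [L] lists the constituents of the regular module. An irreducible character outside [L] has a
    dual orthogonal to all regular coefficients, that is to all of [H^*], although its value at [1]
    is nonzero. *)
Lemma irr_chars_finite : exists L : seq V, uniq L /\ forall x, is_irr_char H x <-> x \in L.
Proof.
have [L [Lirr _ Lcoef]] := hmod_decomp Hss (lreg_mod HH).
exists (undup L); split; first exact: undup_uniq.
move=> x; rewrite mem_undup; split; last exact: Lirr.
case=> m [mu [mM mi ->]]; apply: NNPP => nL.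
have /eqP : ev (hchar mu) (h1 H) = 0.
  rewrite -(hant1 HH HLam Hlam lamLam) -hdualE.
  suff -> : hdual H (hchar mu) = 0 by rewrite (lform0 (hpair_lform_l _)).
  apply: (Lam_nondegr HH HLam Hlam lamLam) => p.
  have [T ->] := mcoef_lreg_surj p.
  apply: (Lcoef T (fun p => ev (p *c hdual H (hchar mu)) Lam = 0)).
  - by rewrite (lmap0 (conv_linl H _)) (lform0 (hpair_lform_l _)).
  - by move=> p1 p2 E1 E2; rewrite (lmapD _ _ (conv_linl H _)) (lformD _ _ (hpair_lform_l _)) E1 E2 addr0.
  move=> m' mu' T' mM' mi' mL'; rewrite -[hchar mu]mcoef1.
  apply: (hom_average Hk HH Hss HLam Hlam HF0 lamLam) => // f fI.
  apply: NNPP => f0; apply: nL.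
  have [n' [u [_ E E0]]] := intertwiner_summand Hss mM' mM mi fI f0.
  by move: mL'; rewrite E E0 // addr0.
rewrite (hchar1 mM) (natr_eq0 Hk); case: mi => m_gt0 _; lia.
Qed.

Lemma sum_count (L M : seq V) (f : V -> k) : uniq L -> {subset M <= L} ->
  \sum_(x <- M) f x = \sum_(i < size L) (count_mem L`_i M)%:R * f L`_i.
Proof.
move=> uL; elim: M => [|x M IH] ML.
  by rewrite big_nil big1 // => i _; rewrite mul0r.
rewrite big_cons IH => [|y yM]; last by apply: ML; rewrite inE yM orbT.
under [RHS]eq_bigr => i _ do rewrite /= natrD mulrDl.
rewrite big_split /=; congr (_ + _).
have xL : x \in L by apply: ML; rewrite inE eqxx.
have ix : (index x L < size L)%N by rewrite index_mem.
rewrite (bigD1 (Ordinal ix)) //= nth_index // eqxx mul1r big1 ?addr0 // => i ii.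
rewrite [x == _]eq_sym; case: eqP => [E|]; last by rewrite mul0r.
by case/eqP: ii; apply: val_inj => /=; rewrite -E index_uniq.
Qed.

(* Perron-Frobenius for multiplication by chi on the irreducible characters. *)
Lemma chi_eigenspace y : inRH H y -> y *c chi = n%:R *: y -> ev y Lam = 0 -> y = 0.
Proof.
move=> yR ychi yL.
have [L [uL LP]] := irr_chars_finite.
have [w wP] : exists w : 'I_(size L) -> nat, forall i, (0 < w i)%N /\ ev L`_i (h1 H) = (w i)%:R.
  apply: (@fin_all_exists _ (fun _ => _) (fun (i : 'I_(size L)) (u : nat) => (0 < u)%N /\ ev L`_i (h1 H) = u%:R)) => i.
  have /LP [m [mu [mM [m_gt0 _] ->]]] : L`_i \in L by exact: mem_nth.
  by exists m; rewrite hchar1.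
have [M MP] : exists M : 'I_(size L) -> seq V, forall i,
    {subset M i <= L} /\ chi *c L`_i = \sum_(x <- M i) x.
  apply: (@fin_all_exists _ (fun _ => _) (fun (i : 'I_(size L)) (M : seq V) => {subset M <= L} /\ chi *c L`_i = \sum_(x <- M) x)) => i.
  have /LP [m [mu [mM _ ->]]] : L`_i \in L by exact: mem_nth.
  have [M [Mirr ME _]] := hmod_decomp Hss (tens_mod HH Hrho mM).
  by exists M; split=> [x /Mirr /LP //|]; rewrite -hchar_tens.
have chi_sum (q : V) (j : 'I_(size L)) x : ev (q *c (chi *c L`_j)) x = \sum_(z <- M j) ev (q *c z) x.
  rewrite (proj2 (MP j)); elim: (M j) => [|z s IH].
    by rewrite !big_nil (lmap0 (conv_linr H _)) (lform0 (hpair_lform_l _)).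
  by rewrite !big_cons (lmapD _ _ (conv_linr H _)) (lformD _ _ (hpair_lform_l _)) IH.
pose A (j i : 'I_(size L)) := count_mem L`_i (M j).
pose Z (j : 'I_(size L)) := L`_j == heps H.
have Aw (j : 'I_(size L)) : (\sum_i A j i * w i = n * w j)%N.
  apply: (natr_inj Hk); rewrite natr_sum natrM -(proj2 (wP j)) -(hchar1 Hrho) -conv_ev1 //.
  rewrite -[_ *c _](conv1l HH) chi_sum (sum_count (fun z => ev (heps H *c z) (h1 H)) uL (proj1 (MP j))).
  by apply: eq_bigr => i _; rewrite natrM conv1l // (proj2 (wP i)).
(* If a closed set missed the trivial character, induction on [l] would give [<chi^l x, Lam> = 0]
   for each of its members [x], against [irr_in_power]. *)
have reach (U : {set 'I_(size L)}) j0 : j0 \in U ->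
    (forall j i, j \in U -> (0 < A j i)%N -> i \in U) -> exists2 j, j \in U & Z j.
  move=> j0U Ucl; apply: NNPP => noZ.
  have E0 l : forall j : 'I_(size L), j \in U -> ev (cpow H chi l *c L`_j) Lam = 0.
    elim: l => [|l IH] j jU.
      rewrite /cpow /= conv1l //; apply/eqP/negPn/negP => Lj.
      apply: noZ; exists j => //; apply/eqP.
      apply: (irr_Lam_neq0 Hk HH Hss HLam Hlam HF0 lamLam) => //.
      by apply/LP; exact: mem_nth.
    rewrite /cpow iterS -/(cpow H chi l) -(convA HH) chi_sum big_seq big1 // => z zM.
    have zL := proj1 (MP j) _ zM; have iz : (index z L < size L)%N by rewrite index_mem.
    rewrite -(nth_index 0 zL); apply: (IH (Ordinal iz)); apply: Ucl jU _.
    by rewrite /A /= nth_index // -has_count has_pred1.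
  have /LP [m [mu [mM [m_gt0 _] Ej]]] : L`_j0 \in L by exact: mem_nth.
  have [l] := irr_in_power Hk HH Hss HLam Hlam HF0 lamLam Hrho Hfaith mM m_gt0.
  by rewrite -Ej E0 // eqxx.
(* The pairings of [y] with the irreducibles satisfy the eigenvector system, and [<y, Lam> = 0] is
   its boundary condition at the trivial character. *)
have c0 (j : 'I_(size L)) : ev (y *c L`_j) Lam = 0.
  move: j; apply: (pf_char0 (n := n) (A := A) (w := w) (Z := Z)) => //.
  - by move=> j; case: (wP j).
  - move=> j _; rewrite -(sum_count (fun z => ev (y *c z) Lam) uL (proj1 (MP j))) -chi_sum.
    by rewrite (convA HH) ychi (lmapZ _ _ (conv_linl H _)) (lformZ _ _ (hpair_lform_l _)).
  by move=> j /eqP ->; rewrite conv1r.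
apply: (inRH_nondeg Hk HH Hss HLam Hlam HF0 lamLam) => //.
apply: inRH_sum => [|a p q E1 E2|x /LP xL].
- by rewrite (lmap0 (conv_linr H _)) (lform0 (hpair_lform_l _)).
- by rewrite conv_linr hpair_lform_l E1 E2 mulr0 addr0.
have ix : (index x L < size L)%N by rewrite index_mem.
by have := c0 (Ordinal ix); rewrite /= nth_index.
Qed.

End Powers.

(** * The integral as a polynomial in the faithful character *)

Theorem theorem3p8 (k : closedFieldType) (d : nat) (H : hopf k d)
  (Hk : [pchar k] =i pred0) (HH : is_hopf H) (Hss : semisimple H)
  (Hcomm : forall p q, inRH H p -> inRH H q -> conv H p q = conv H q p)
  (Lam lam : 'rV[k]_d) (HLam : is_integral H Lam) (Hlam : is_dual_integral H lam)
  (HF0 : conv H (d%:R^-1 *: lam) (d%:R^-1 *: lam) = d%:R^-1 *: lam)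
  (HlamLam : hpair lam Lam = 1)
  (n : nat) (rho : 'I_d -> 'M[k]_n) (Hrho : is_hmod H rho)
  (Hfaith : faithful_char H rho)
  (s : seq k) (Hs : uniq s)
  (Hsdef : forall z, z \in s <->
     exists F, prim_idem H F /\ z = hpair (hchar rho) (hEta H Lam F)) :
  forall (m : nat) (mu : 'I_d -> 'M[k]_m), is_hmod H mu -> irr_mod mu ->
  exists2 j, (j < size s)%N &
    exists (n' : nat) (u : 'I_d -> 'M[k]_n'),
      is_hmod H u /\ cpow H (hchar rho) j = hchar mu + hchar u.
Proof.
move=> m mu mM mi.
case: d => [|d] in H HH Hss Hcomm Lam lam HLam Hlam HF0 HlamLam rho Hrho Hfaith Hsdef mu mM mi *.
  by have := d_neq0 Hk HH; rewrite eqxx.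
set chi := hchar rho.
have lamR : inRH H lam.
  rewrite (lam_chreg Hk HH Hss HLam Hlam HF0 HlamLam).
  by apply: hchar_inRH => //; exact: lreg_mod.
have ns : n%:R \in s.
  apply/Hsdef; exists (d.+1%:R^-1 *: lam); split.
    exact: (lam_prim_idem Hk HH Hss HLam Hlam HF0 HlamLam Hcomm).
  by rewrite (chi_lam_eta Hk HH Hss HLam Hlam HF0 HlamLam Hcomm).
(* Dropping the factor at [n] makes [Q(chi)] an eigenvector for [n], since the full product
   annihilates [chi]. *)
pose Q := \prod_(z <- rem n%:R s) ('X - z%:P).
pose Y := cpeval H chi Q.
have YE : Y = hpair Y Lam *: lam.
  have chiY : conv H Y chi = n%:R *: Y.
    apply/eqP; rewrite -subr_eq0 -scaleNr; apply/eqP.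
    rewrite -[X in conv H Y X](cpevalX HH) -cpevalM // -cpevalZ // -cpevalD //.
    rewrite -(prod_chi_eq0 Hk HH Hss HLam Hlam HF0 HlamLam Hcomm Hrho (s := s)); last first.
      by move=> F Fp; apply/Hsdef; exists F.
    rewrite (perm_big _ (perm_to_rem ns)) big_cons -/Q; congr cpeval.
    rewrite -mul_polyC polyCN /=.
    by ring.
  (* Subtracting [<Y, Lam> lam] leaves an eigenvector for [n] killed by [Lam], which vanishes by
     [chi_eigenspace]. *)
  apply/eqP; rewrite -subr_eq0; apply/eqP.
  apply: (chi_eigenspace Hk HH Hss HLam Hlam HF0 HlamLam Hrho Hfaith).
  - rewrite -scaleNr addrC; apply: inRHD; first exact: inRHZ.
    exact: (cpeval_inRH HH Hss Hrho).
  - rewrite (lmapB _ _ (conv_linl H _)) chiY (lmapZ _ _ (conv_linl H _)) (proj2 (Hlam _)).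
    by rewrite (hchar1 Hrho) scalerBr !scalerA mulrC.
  - rewrite (lformB _ _ (hpair_lform_l _)) (lformZ _ _ (hpair_lform_l _)).
    by rewrite HlamLam mulr1 subrr.
(* Otherwise [Y = 0], whereas [Y(1) = Q(n)] is a product of nonzero differences [n - z]. *)
have YL : hpair Y Lam != 0.
  apply/eqP => Y0; have := ev1_cpeval HH chi Q; rewrite -/Y YE Y0 scale0r.
  rewrite (lform0 (hpair_lform_l _)) (hchar1 Hrho) horner_prod => /esym/eqP.
  rewrite prodf_seq_eq0 => /hasP [z]; rewrite mem_rem_uniq // inE => /andP [zn _].
  by rewrite hornerXsubC subr_eq0 eq_sym (negPf zn).
apply: NNPP => no.
have pow0 j : (j < size s)%N -> hpair (conv H (cpow H chi j) (hdual H (hchar mu))) Lam = 0.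
  move=> js; apply/eqP/negPn/negP => ne0; apply: no; exists j => //.
  have [m' [X [XM XE]]] := cpow_module HH Hrho j.
  rewrite -/chi in XE; rewrite -XE in ne0 *.
  have [n' [u [uM uE _]]] := hchar_summand Hk HH Hss HLam Hlam HF0 HlamLam XM mM mi ne0.
  by exists n', u.
have : hpair (conv H Y (hdual H (hchar mu))) Lam = 0.
  rewrite /Y /cpeval.
  have -> : size Q = size s.
    by rewrite size_prod_XsubC size_rem // prednK // -has_predT; apply/hasP; exists n%:R.
  have linL : lform (fun p => hpair (conv H p (hdual H (hchar mu))) Lam).
    by move=> a p q; rewrite conv_linl hpair_lform_l.
  rewrite (lform_sum _ _ _ linL) big1 // => i _.
  by rewrite (lformZ _ _ linL) pow0 ?mulr0.
(* On the other hand this pairing is [<Y, Lam>] times the dimension [m] of [mu], a nonzero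
   number. *)
rewrite YE (lmapZ _ _ (conv_linl H _)) (proj2 (Hlam _)) !(lformZ _ _ (hpair_lform_l _)).
rewrite HlamLam mulr1 hdualE (hant1 HH HLam Hlam HlamLam) (hchar1 mM) => /eqP.
rewrite mulf_eq0 (negPf YL) (natr_eq0 Hk) /=; case: mi => m_gt0 _; lia.
Qed.
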